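(* Let $k$ be a field and consider the polynomial ring $k[x_1,\ldots,x_n]$. Given a dataset size $m$, maximum degrees $d,d'>0$, a maximum size of non-Gröbner set $s_{\max}\ge n$, and a term order $\prec$, the dataset generation algorithm described in the context returns a collection $\mathcal{D}=\{(F_i,G_i)\}_{i=1}^m$ with the following properties. For all $i=1,\ldots,m$: 1. $|G_i|=n$ and $|F_i|\le s_{\max}$. 2. The set $G_i$ is the reduced $\prec$-Gröbner basis of $\langle F_i\rangle$. The set $F_i$ is not, unless $G_i,U_1,U_2',P$ are all sampled in a non-trivial Zariski closed subset (this can happen with probability zero if $k$ is infinite and with very low probability over a large finite field). 3. The ideal $\langle F_i\rangle=\langle G_i\rangle$ is a $0$-dimensional ideal in shape position. The time complexity is $\mathcal{O}\bigl(m(nS_{1,d}+s^2S_{n,d'}+(n^2+s^2)M_{n,2d'+d})\bigr)$ when $\prec\,=\,\prec_{\mathrm{lex}}$, where $s$ denotes the sampled number of polynomials of the non-Gröbner set ($n\le s\le s_{\max}$), $S_{n,d}$ denotes the complexity of sampling an $n$-variate polynomial with total degree at most $d$, and $M_{n,d}$ denotes that of multiplying two $n$-variate polynomials with total degree at most $d$. If $\prec\,\neq\,\prec_{\mathrm{lex}}$, an additional $\mathcal{O}(mnd^3)$ is needed.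
   Context: Notation. $\langle F\rangle$ is the ideal generated by $F$; $k[x_1,\ldots,x_n]_{\le d}$ is the set of polynomials of total degree at most $d$; $\mathrm{ST}(r,R_{\le d'})$, with $R=k[x_1,\ldots,x_n]$, is the set of $r\times r$ upper-triangular matrices with all diagonal entries equal to $1$ and entries in $R_{\le d'}$. The order $\prec_{\mathrm{lex}}$ is lexicographic with $x_1\succ\cdots\succ x_n$. For a term order $\prec$, $\mathrm{LT}(f)$ is the $\prec$-largest term of $f$, and $\mathrm{LT}(S)=\{\mathrm{LT}(f): f\in S\}$ (over nonzero $f$). A finite subset $G$ of an ideal $I$ is a $\prec$-Gröbner basis of $I$ if $\langle\mathrm{LT}(G)\rangle=\langle\mathrm{LT}(I)\rangle$; it is reduced if each element has leading coefficient $1$ and no term of any $g\in G$ lies in $\langle \mathrm{LT}(G\setminus\{g\})\rangle$. An ideal $I$ is $0$-dimensional if $k[x_1,\ldots,x_n]/I$ is finite-dimensional over $k$. It is in shape position if its reduced $\prec_{\mathrm{lex}}$-Gröbner basis has the form $\{h,x_1-g_1,\ldots,x_{n-1}-g_{n-1}\}$ with $h,g_1,\ldots,g_{n-1}\in k[x_n]$. Algorithm. Input: $m,d,d',s_{\max},\prec$. Start with $\mathcal{D}=\emptyset$. For each $i=1,\ldots,m$: (a) sample a non-constant monic $h\in k[x_n]_{\le d}$; (b) for $j=1,\ldots,n-1$ sample $g_j\in k[x_n]_{\le \deg(h)-1}$, and set $G_i=\{h,x_1-g_1,\ldots,x_{n-1}-g_{n-1}\}$ (also regarded as a column vector); (c)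 sample an integer $s$ uniformly from $\{n,\ldots,s_{\max}\}$; (d) sample $U_1\in\mathrm{ST}(s,R_{\le d'})$, $U_2'\in\mathrm{ST}(n,R_{\le d'})$, and a permutation matrix $P\in\{0,1\}^{s\times s}$; (e) let $U_2\in R^{s\times n}$ be $U_2'$ stacked on top of the $(s-n)\times n$ zero matrix, and let $F_i$ be the set of entries of $U_1PU_2G_i$; (f) if $\prec\neq\prec_{\mathrm{lex}}$, replace $G_i$ by the output of the FGLM change-of-ordering algorithm, which converts the reduced $\prec_{\mathrm{lex}}$-Gröbner basis $G_i$ of the $0$-dimensional ideal $\langle G_i\rangle$ into its reduced $\prec$-Gröbner basis using $\mathcal{O}(n\deg(h)^3)$ arithmetic operations in $k$; (g) add $(F_i,G_i)$ to $\mathcal{D}$. Return $\mathcal{D}$. In item 2, the Zariski closed subset is taken in the space parametrizing the sampled data $(G_i,U_1,U_2',P)$ through the coefficients of the sampled polynomials.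
   Formalization: |G_i|=n is claimed for the sampled G_i (equal to the returned one if the order is lex), being false after FGLM in general; the closed subset is proper only for s>1, as F_i=G_i if n=s=1; the probability remark becomes a bound c/|A| for coefficients uniform in a finite set A. *)

(* Defs.v *)
From HB Require Import structures.
From mathcomp Require Import all_boot all_algebra.
From mathcomp Require Import perm finmap.
From mathcomp.multinomials Require Import mpoly.
From Stdlib Require Import ClassicalEpsilon.

Set Implicit Arguments.
Unset Strict Implicit.
Unset Printing Implicit Defensive.

Import GRing.Theory.

Local Open Scope ring_scope.

(* The polynomial ring has n'.+1 >= 1 variables; x_1, ..., x_n are
   'X_0, ..., 'X_n', so that x_n is 'X_ord_max. *)

Section TermOrders.
Variable n : nat.

Definition term_order (le : rel 'X_{1..n}) : Prop :=
  [/\ total le, antisymmetric le, transitive le,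
      forall m : 'X_{1..n}, le 0%MM m
    & forall m1 m2 m : 'X_{1..n}, le m1 m2 -> le (m1 + m)%MM (m2 + m)%MM].

Definition lexle : rel 'X_{1..n} := fun a b =>
  (a == b) ||
  [exists i : 'I_n, (a i < b i)%N && [forall j : 'I_n, (j < i)%N ==> (a j == b j)]].

End TermOrders.

Section Groebner.
Variables (k : fieldType) (n : nat).
Local Notation R := {mpoly k[n]}.
Implicit Types (le : rel 'X_{1..n}) (S I : R -> Prop) (G : {fset R}) (p : R).

Definition ideal S : R -> Prop := fun p =>
  exists2 c : seq (R * R),
    (forall x, x \in c -> S x.2) & p = \sum_(x <- c) x.1 * x.2.

Definition ideal_of G : R -> Prop := ideal (fun p => p \in G).

(* The fold starts at the least monomial 0; lead_mon le 0 = 0 is a dummy value. *)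
Definition lead_mon le p : 'X_{1..n} :=
  foldr (fun a b => if le a b then b else a) 0%MM (msupp p).
Definition lead_cf le p : k := p@_(lead_mon le p).
Definition lead_term le p : R := lead_cf le p *: 'X_[lead_mon le p].

Definition lead_terms le S : R -> Prop := fun t =>
  exists p, [/\ S p, p != 0 & t = lead_term le p].

Definition groebner le I G : Prop :=
  (forall g, g \in G -> I g) /\
  (forall p, ideal (lead_terms le (fun g => g \in G)) p <->
             ideal (lead_terms le I) p).

Definition reduced_groebner le I G : Prop :=
  groebner le I G /\
  forall g, g \in G ->
    lead_cf le g = 1 /\
    forall m, m \in msupp g ->
      ~ ideal (lead_terms le (fun f => f \in (G `\ g)%fset)) (g@_m *: 'X_[m]).

(* k[x]/I is spanned over k by the classes of finitely many polynomials. *)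
Definition zero_dim I : Prop :=
  exists B : seq R, forall p, exists c : R -> k,
    I (p - \sum_(b <- B) c b *: b).

End Groebner.

Section ShapePosition.
Variables (k : fieldType) (n' : nat).
Local Notation n := n'.+1.
Local Notation R := {mpoly k[n]}.

(* k[x_n] inside R *)
Definition in_last (p : {poly k}) : R := horner_alg 'X_ord_max p.

Definition head_var (j : 'I_n') : R := 'X_(widen_ord (leqnSn n') j).

(* The column vector (h, x_1 - g_1, ..., x_{n-1} - g_{n-1}). *)
Definition shape_col (h : {poly k}) (g : 'I_n' -> {poly k}) : 'cV[R]_n :=
  \col_i (if unlift ord0 i is Some j then head_var j - in_last (g j)
          else in_last h).

Definition entries s (v : 'cV[R]_s) : {fset R} := [fset v i 0 | i in 'I_s]%fset.

Definition shape_set h g : {fset R} := entries (shape_col h g).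

Definition shape_position (I : R -> Prop) : Prop :=
  exists h g, reduced_groebner (@lexle n) I (shape_set h g).

End ShapePosition.

(* Running times: a computation returns its result together with its cost. *)
Definition timed (A : Type) : Type := (A * nat)%type.
Definition ret A (a : A) : timed A := (a, 0%N).
Definition charge A (c : nat) (a : A) : timed A := (a, c).
Definition bind A B (x : timed A) (f : A -> timed B) : timed B :=
  ((f x.1).1, (x.2 + (f x.1).2)%N).
Definition for_all p A (f : 'I_p -> timed A) : timed ('I_p -> A) :=
  (fun i => (f i).1, (\sum_(i < p) (f i).2)%N).
Fixpoint fold_timed A B (f : B -> A -> timed B) (b : B) (s : seq A) : timed B :=
  if s is a :: s' then bind (f b a) (fun b' => fold_timed f b' s') else ret b.

Notation "'let*' x := m 'in' f" := (bind m (fun x => f))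
  (at level 200, x name, m at level 200, f at level 200).

(* Unit costs. The first argument of cost_sample, cost_mul and cost_add is the
   number of variables and the second one bounds the total degree of the
   polynomials sampled, resp. of both operands: cost_sample is S and cost_mul
   is M. cost_perm s is the cost of sampling a permutation matrix of size s. *)
Record costs := Costs {
  cost_sample : nat -> nat -> nat;
  cost_mul : nat -> nat -> nat;
  cost_add : nat -> nat -> nat;
  cost_int : nat;
  cost_perm : nat -> nat }.

Definition admissible (c0 : nat) (K : costs) : Prop :=
  [/\ forall v, {homo cost_sample K v : e f / (e <= f)%N},
      forall v e, (0 < cost_sample K v e)%N,
      forall v, {homo cost_mul K v : e f / (e <= f)%N},
      forall v e, (cost_add K v e <= c0 * cost_mul K v e)%N
    & (cost_int K <= c0)%N /\ forall s, (cost_perm K s <= c0 * s ^ 2)%N].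

Section Algorithm.
Variables (k : fieldType) (n' : nat).
Local Notation n := n'.+1.
Local Notation R := {mpoly k[n]}.

Definition tdeg (p : R) : nat := (msize p).-1.

(* ST(r, R_{<= e}) *)
Definition unitri (e r : nat) (U : 'M[R]_r) : Prop :=
  forall i j : 'I_r, [/\ (j < i)%N -> U i j = 0,
                         i = j -> U i j = 1
                       & (msize (U i j) <= e.+1)%N].

(* Everything drawn during one pass of the loop, for a given value of s. *)
Record sample (s : nat) := Sample {
  smp_h : {poly k};
  smp_g : 'I_n' -> {poly k};
  smp_U1 : 'M[R]_s;
  smp_U2 : 'M[R]_n;
  smp_P : 'S_s }.

(* size p is deg p + 1. *)
Definition valid_sample (d d' smax s : nat) (x : sample s) : Prop :=
  [/\ smp_h x \is monic /\ (1 < size (smp_h x) <= d.+1)%N,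
      forall j, (size (smp_g x j) <= (size (smp_h x)).-1)%N,
      (n <= s <= smax)%N,
      unitri d' (smp_U1 x)
    & unitri d' (smp_U2 x)].

Definition stack s (U : 'M[R]_n) : 'M[R]_(s, n) :=
  \matrix_(i < s, j < n) (if (i < n)%N then U (inord i) j else 0).

Variable K : costs.

Definition add_timed (p q : R) : timed R :=
  charge (cost_add K n (maxn (tdeg p) (tdeg q))) (p + q).
Definition sub_timed (p q : R) : timed R :=
  charge (cost_add K n (maxn (tdeg p) (tdeg q))) (p - q).
Definition mul_timed (p q : R) : timed R :=
  charge (cost_mul K n (maxn (tdeg p) (tdeg q))) (p * q).

Definition mulmx_timed p q (A : 'M[R]_(p, q)) (v : 'cV[R]_q) : timed 'cV[R]_p :=
  let* w := for_all (fun i : 'I_p =>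
    fold_timed (fun acc j => let* t := mul_timed (A i j) (v j 0) in add_timed acc t)
               0 (enum 'I_q)) in
  ret (\col_i w i).

Definition shape_timed (h : {poly k}) (g : 'I_n' -> {poly k}) : timed 'cV[R]_n :=
  let* w := for_all (fun j : 'I_n' => sub_timed (head_var k j) (in_last n' (g j))) in
  ret (\col_i (if unlift ord0 i is Some j then w j else in_last n' h)).

Variables (le : rel 'X_{1..n}) (fglm : {fset R} -> timed {fset R}).
Variables (d d' : nat).

(* One pass of the loop, run on the drawn data x. A matrix of ST(r, R_{<= d'})
   has 'C(r, 2) free entries. U_1 P U_2 G is computed from right to left, by
   schoolbook matrix-vector products that also charge the products by 0 and 1. *)
Definition iteration s (x : sample s) : timed ({fset R} * {fset R}) :=
  let* h := charge (cost_sample K 1 d) (smp_h x) in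
  let* g := for_all (fun j : 'I_n' => charge (cost_sample K 1 (size h).-2) (smp_g x j)) in
  let* G := shape_timed h g in
  let* sz := charge (cost_int K) s in
  let* U1 := charge ('C(sz, 2) * cost_sample K n d') (smp_U1 x) in
  let* U2 := charge ('C(n, 2) * cost_sample K n d') (smp_U2 x) in
  let* P := charge (cost_perm K sz) (smp_P x) in
  let* v := mulmx_timed (stack _ U2) G in
  let* v := mulmx_timed (perm_mx P) v in
  let* v := mulmx_timed U1 v in
  let* G' := (if excluded_middle_informative (le =2 @lexle n)
              then ret (entries G) else fglm (entries G)) in
  ret (entries v, G').

Definition dataset m (s : 'I_m -> nat) (x : forall i, sample (s i)) :
    timed ('I_m -> {fset R} * {fset R}) :=
  for_all (fun i => iteration (x i)).

End Algorithm.

(* What is known of the FGLM algorithm for the target order le. *)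
Definition fglm_spec (k : fieldType) (n' c0 : nat) (le : rel 'X_{1..n'.+1})
    (fglm : {fset {mpoly k[n'.+1]}} -> timed {fset {mpoly k[n'.+1]}}) : Prop :=
  forall G : {fset {mpoly k[n'.+1]}},
    reduced_groebner (@lexle n'.+1) (ideal_of G) G -> zero_dim (ideal_of G) ->
    reduced_groebner le (ideal_of G) (fglm G).1 /\
    forall (h : {poly k}) (g : 'I_n' -> {poly k}),
      (1 < size h)%N -> G = shape_set h g ->
      ((fglm G).2 <= c0 * (n'.+1 * (size h).-1 ^ 3))%N.

Section Zariski.
Variables (k : fieldType) (n' d' : nat).
Local Notation n := n'.+1.

Definition above_diag (r : nat) : finType := {ij : 'I_r * 'I_r | (ij.1 < ij.2)%N}.

(* Coordinates on the sampled data with deg h = D, for fixed s and fixed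
   permutation: the nonleading coefficients of h, the coefficients of the g_j,
   and those of the entries above the diagonal of U_1 and of U_2'. For each
   (D, s, P) the data thus form an affine space, and the whole parameter
   space is the disjoint union of these affine spaces. *)
Definition param (D s : nat) : finType :=
  ('I_D + 'I_n' * 'I_D
   + above_diag s * 'X_{1..n < d'.+1} + above_diag n * 'X_{1..n < d'.+1})%type.

Definition param_val (D s : nat) (x : sample k n' s) (t : param D s) : k :=
  match t with
  | inl (inl (inl a)) => (smp_h x)`_a
  | inl (inl (inr (j, a))) => (smp_g x j)`_a
  | inl (inr (ij, m)) => (smp_U1 x (val ij).1 (val ij).2)@_(bmnm m)
  | inr (ij, m) => (smp_U2 x (val ij).1 (val ij).2)@_(bmnm m)
  end.

Variable T : finType.

Definition zeros (E : seq {mpoly k[#|T|]}) (v : T -> k) : bool :=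
  all (fun q : {mpoly k[#|T|]} => q.@[fun i => v (enum_val i)] == 0) E.

Definition proper_closed (E : seq {mpoly k[#|T|]}) : Prop :=
  exists v : T -> k, ~~ zeros E v.

(* A point whose coordinates are drawn independently and uniformly from a finite
   set A of scalars lies in the closed set with probability at most c / #|A|. *)
Definition rare (c : nat) (E : seq {mpoly k[#|T|]}) : Prop :=
  forall A : {fset k},
    (#|[set f : {ffun T -> A} | zeros E (fun t => val (f t))]| * #|` A|%fset
       <= c * #|{ffun T -> A}|)%N.

End Zariski.

(* Main.v *)
(** A lexicographic leading term of an element of <h, x_j - g_j> that avoids all
    x_j forces the whole polynomial to lie in k[x_n], where evaluation at
    x_j = g_j shows that h divides it; hence the shape set is a reduced Groebner
    basis. U_1 P U_2 has a left inverse, so F generates the same ideal, and a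
    Groebner basis for another order generates it too, by division (term orders
    are well-founded by Dickson's lemma).

    For the genericity statement, let w be the last row of P U_2 G, which is also
    the last element of F, and let the row above give the element w' + u w of F,
    with u the last superdiagonal entry of U_1. If w = 0, then F is never reduced.
    Otherwise let M be the largest monomial that occurs in w for some value of
    the parameters. If the coefficient of M in w and that of x_1 M in w' + u w
    are both nonzero, then LT(w) divides a term of w' + u w, so F is not reduced.
    The first coefficient vanishes with probability at most 2/|A|, because it is
    affine in the entries of U_2 with slopes affine in one coefficient of G; the
    second one is affine in the coefficient of x_1 in u, with slope the first
    one. No lower bound on the size of k is needed. *)
Require Import Defs.
From HB Require Import structures.
From mathcomp Require Import all_boot all_algebra.
From mathcomp Require Import perm finmap.
From mathcomp.multinomials Require Import mpoly.
From mathcomp Require Import zify.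
From Stdlib Require Import Classical ClassicalEpsilon FunctionalExtensionality.

Set Implicit Arguments.
Unset Strict Implicit.
Unset Printing Implicit Defensive.

Import GRing.Theory.

Local Open Scope ring_scope.

(** * Dickson's lemma *)

Lemma nondecreasing_subsequence (g : nat -> nat) :
  exists2 phi : nat -> nat, {homo phi : i j / (i < j)%N} &
    forall i j, (i <= j)%N -> (g (phi i) <= g (phi j))%N.
Proof.
(* Every tail of [g] attains its minimum. Choosing each index of [phi] at a minimum of the tail
   beyond the previous index makes [g] nondecreasing along [phi]. *)
have tail_min N : {i | (N <= i)%N /\ forall j, (N <= j)%N -> (g i <= g j)%N}.
  apply: constructive_indefinite_description.
  suff min_from v i : (N <= i)%N -> (g i <= v)%N ->
      exists j, (N <= j)%N /\ forall j', (N <= j')%N -> (g j <= g j')%N.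
    exact: min_from (leqnn N) (leqnn _).
  elim: v i => [|v IHv] i Ni giv.
    by exists i; split=> // j _; move: giv; rewrite leqn0 => /eqP->.
  case: (classic (exists2 j, (N <= j)%N & (g j < g i)%N)).
    by case=> j Nj ltj; apply: (IHv j Nj); have := leq_trans ltj giv; rewrite ltnS.
  move=> nex; exists i; split=> // j Nj; rewrite leqNgt; apply/negP => ltj.
  by apply: nex; exists j.
pose phi := fix phi i := sval (tail_min (if i is i'.+1 then (phi i').+1 else 0%N)).
pose start i := if i is i'.+1 then (phi i').+1 else 0%N.
have phiP i : (start i <= phi i)%N /\ forall j, (start i <= j)%N -> (g (phi i) <= g j)%N.
  by case: i => [|i]; exact: (svalP (tail_min (start _))).
have phiS i : (phi i < phi i.+1)%N by have [] := phiP i.+1.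
have phi_homo : {homo phi : i j / (i < j)%N} by apply: homo_ltn phiS; exact: ltn_trans.
exists phi => // i j; rewrite leq_eqVlt => /predU1P[-> //|ltij].
apply: (phiP i).2; case: i ltij => [//|i] ltij.
by apply/phi_homo/ltnW.
Qed.

(** Thinning the sequence once per variable makes every exponent nondecreasing, so the first two
    remaining terms already divide one another. *)
Lemma dickson n (f : nat -> 'X_{1..n}) :
  exists i j, (i < j)%N && (f i <= f j)%MM.
Proof.
have [phi homo_phi le_phi] : exists2 phi : nat -> nat,
    {homo phi : i j / (i < j)%N} &
    forall c, c \in enum 'I_n -> forall i j, (i <= j)%N -> (f (phi i) c <= f (phi j) c)%N.
  elim: (enum 'I_n) => [|c r [phi homo_phi le_phi]]; first by exists id.
  have [psi homo_psi le_psi] := nondecreasing_subsequence (fun i => f (phi i) c).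
  exists (phi \o psi) => [i j /homo_psi/homo_phi //|c' ].
  rewrite inE => /predU1P[-> //|c'r] i j leij /=.
  apply: le_phi => //; move: leij; rewrite leq_eqVlt => /predU1P[-> //|].
  by move=> /homo_psi/ltnW.
exists (phi 0%N), (phi 1%N); rewrite homo_phi //=.
by apply/mnm_lepP => c; apply: le_phi => //; rewrite mem_enum.
Qed.

(** * Term orders: well-foundedness and maxima of finite lists *)

Section TermOrderTheory.
Variables (n : nat) (le : rel 'X_{1..n}).
Hypothesis leT : term_order le.

Lemma term_order_refl m : le m m.
Proof. by case: leT => tot _ _ _ _; have := tot m m; rewrite orbb. Qed.

Lemma term_order_trans : transitive le.
Proof. by case: leT. Qed.

Lemma term_order_anti m1 m2 : le m1 m2 -> le m2 m1 -> m1 = m2.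
Proof. by case: leT => _ anti _ _ _ ? ?; apply: anti; apply/andP. Qed.

Lemma term_order_ge0 m : le 0%MM m.
Proof. by case: leT. Qed.

Lemma term_order_add2r m m1 m2 : le m1 m2 -> le (m1 + m)%MM (m2 + m)%MM.
Proof. by case: leT => _ _ _ _; apply. Qed.

Lemma term_order_total m1 m2 : le m1 m2 || le m2 m1.
Proof. by case: leT. Qed.

Lemma term_order_dvd m1 m2 : (m1 <= m2)%MM -> le m1 m2.
Proof.
by move=> /submK <-; rewrite -{1}[m1]add0m; apply/term_order_add2r/term_order_ge0.
Qed.

(** A non-accessible monomial starts an infinite strictly descending sequence. By Dickson's lemma an
    earlier term divides a later one, hence is at most that one, against the descent. *)
Lemma term_order_wf : well_founded (fun m1 m2 => le m1 m2 && (m1 != m2)).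
Proof.
pose lt m1 m2 := le m1 m2 && (m1 != m2); change (well_founded lt) => m0.
case: (classic (Acc lt m0)) => [//|nacc].
have next (m : {m | ~ Acc lt m}) : {m' : {m | ~ Acc lt m} | lt (sval m') (sval m)}.
  apply: constructive_indefinite_description.
  case: m => m nm; case: (classic (exists m', lt m' m /\ ~ Acc lt m')).
    by case=> m' [? nm']; exists (exist _ m' nm').
  move=> nex; case: nm; constructor => m' lm'; apply: NNPP => nm'.
  by apply: nex; exists m'.
have [f fS] : exists f : nat -> 'X_{1..n}, forall i, lt (f i.+1) (f i).
  exists (fun i => sval (iter i (fun m => sval (next m)) (exist _ m0 nacc))) => i.
  by rewrite iterS; exact: (svalP (next _)).
have f_homo i j : (i < j)%N -> lt (f j) (f i).
  elim: j => // j IHj; rewrite ltnS leq_eqVlt => /predU1P[->|/IHj]; first exact: fS.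
  case/andP: (fS j) => le1 ne1 /andP[le2 ne2].
  rewrite /lt (term_order_trans le1 le2); apply/eqP => e; case/eqP: ne2.
  by apply: term_order_anti le2 _; rewrite -e.
have [i [j /andP[ltij /term_order_dvd leij]]] := dickson f.
by have /andP[leji /eqP[]] := f_homo _ _ ltij; apply: term_order_anti.
Qed.

Let maxm := fun a b => if le a b then b else a.

Lemma foldr_term_order_max (s : seq 'X_{1..n}) m :
  m \in s -> foldr maxm 0%MM s \in s /\ le m (foldr maxm 0%MM s).
Proof.
have ub (r : seq 'X_{1..n}) m' : m' \in r -> le m' (foldr maxm 0%MM r).
  elim: r => // a r IHr; rewrite inE /= {1}/maxm => /predU1P[->|/IHr le_m'].
    by case: ifP => // _; apply: term_order_refl.
  case: ifP => // /negbT nle; apply: term_order_trans le_m' _.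
  by have := term_order_total a (foldr maxm 0%MM r); rewrite (negPf nle).
move=> ms; split; last exact: ub.
have: foldr maxm 0%MM s = 0%MM \/ foldr maxm 0%MM s \in s.
  elim: {m ms} s => [|a r IHr]; first by left.
  rewrite /= {1 3}/maxm; case: ifP => [_|_]; last by right; rewrite mem_head.
  by case: IHr => [->|max_r]; [left | right; rewrite inE max_r orbT].
(* If the fold returns its starting value 0, then [m] is at most 0, so [m] is 0 and the value lies
   in [s] after all. *)
case=> // e0; have := ub _ _ ms; rewrite e0 => m0.
by rewrite -(term_order_anti m0 (term_order_ge0 m)).
Qed.

End TermOrderTheory.

(** * Leading monomials *)

Section LeadingMonomials.
Variables (k : fieldType) (n : nat) (le : rel 'X_{1..n}).
Hypothesis leT : term_order le.
Local Notation R := {mpoly k[n]}.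
Implicit Types (p g : R) (I : R -> Prop) (G : {fset R}).

Lemma lead_mon_supp p : p != 0 -> lead_mon le p \in msupp p.
Proof.
move=> p0; case E: (msupp p) => [|m s].
  by case/negP: p0; apply/eqP/mpolyP => m; rewrite mcoeff0 memN_msupp_eq0 ?E.
rewrite -E; have mp : m \in msupp p by rewrite E mem_head.
exact: (foldr_term_order_max leT mp).1.
Qed.

Lemma lead_mon_max p m : m \in msupp p -> le m (lead_mon le p).
Proof. by move=> /(foldr_term_order_max leT)[]. Qed.

Lemma lead_cf_neq0 p : p != 0 -> lead_cf le p != 0.
Proof. by move=> /lead_mon_supp; rewrite mcoeff_msupp. Qed.

Lemma lead_mon_eq p m :
  m \in msupp p -> (forall m', m' \in msupp p -> le m' m) -> lead_mon le p = m.
Proof.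
move=> mp max_m; apply: (term_order_anti leT); last exact: lead_mon_max.
by apply/max_m/lead_mon_supp; apply/eqP => p0; rewrite p0 msupp0 in mp.
Qed.

Lemma eq_lead_mon le' p : le =2 le' -> lead_mon le p = lead_mon le' p.
Proof. by move=> e; rewrite /lead_mon; elim: (msupp p) => //= m s ->; rewrite e. Qed.

End LeadingMonomials.

(** * Ideals, ideals of leading terms and Groebner bases *)

Section Ideals.
Variables (k : fieldType) (n : nat).
Local Notation R := {mpoly k[n]}.
Implicit Types (p q g : R) (S I : R -> Prop) (G : {fset R}).

Lemma ideal_sub S p : S p -> ideal S p.
Proof.
move=> Sp; exists [:: (1, p)]; last by rewrite big_seq1 mul1r.
by move=> x; rewrite inE => /eqP->.
Qed.

Lemma ideal0 S : ideal S 0.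
Proof. by exists [::] => //; rewrite big_nil. Qed.

Lemma idealD S p q : ideal S p -> ideal S q -> ideal S (p + q).
Proof.
move=> [c Sc ->] [d Sd ->]; exists (c ++ d); last by rewrite big_cat.
by move=> x; rewrite mem_cat => /orP[/Sc|/Sd].
Qed.

Lemma idealM S p q : ideal S q -> ideal S (p * q).
Proof.
move=> [c Sc ->]; exists [seq (p * x.1, x.2) | x <- c].
  by move=> _ /mapP[x xc ->] /=; apply: Sc.
by rewrite big_map big_distrr; apply: eq_bigr => x _ /=; rewrite mulrA.
Qed.

Lemma idealZ S c p : ideal S p -> ideal S (c *: p).
Proof. by rewrite -mul_mpolyC; apply: idealM. Qed.

Lemma idealN S p : ideal S p -> ideal S (- p).
Proof. by rewrite -mulN1r; apply: idealM. Qed.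

Lemma idealB S p q : ideal S p -> ideal S q -> ideal S (p - q).
Proof. by move=> Sp Sq; apply/idealD/idealN. Qed.

Lemma ideal_sum S (J : Type) (r : seq J) (F : J -> R) :
  (forall j, ideal S (F j)) -> ideal S (\sum_(j <- r) F j).
Proof.
by move=> SF; elim/big_rec: _ => [|j p _]; [apply: ideal0 | apply: idealD].
Qed.

Lemma ideal_mono S I :
  (forall p, S p -> ideal I p) -> forall p, ideal S p -> ideal I p.
Proof.
move=> SI p [c Sc ->]; rewrite big_seq; elim/big_rec: _ => [|x q xc].
  exact: ideal0.
by apply/idealD/idealM/SI/Sc.
Qed.

(** Some summand must contribute to the coefficient of [m], and all monomials of a multiple of a
    leading term are divisible by its monomial. *)
Lemma ideal_lead_terms_dvd le S p m : ideal (lead_terms le S) p -> m \in msupp p ->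
  exists g, [/\ S g, g != 0 & (lead_mon le g <= m)%MM].
Proof.
move=> [c Sc ->]; rewrite mcoeff_msupp raddf_sum /=.
case: (classic (exists x, x \in c /\ (x.1 * x.2)@_m != 0)).
  case=> x [xc nz] _; have [g [Sg g0 ex]] := Sc x xc.
  exists g; split=> //; apply/negP => nle; move/eqP: nz; apply.
  have /memN_msupp_eq0 : m \notin msupp (x.1 * x.2); last by [].
  rewrite ex /lead_term -scalerAr; apply/negP => /msuppZ_le.
  rewrite (perm_mem (msuppMX _ _)) => /mapP[m' _ e]; apply: nle.
  by rewrite e lem_addr.
move=> nex /eqP[]; rewrite big_seq big1 // => x xc; apply/eqP/negPn/negP => nz.
by apply: nex; exists x.
Qed.

Lemma ideal_lead_terms_intro le S g c m : term_order le ->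
  S g -> g != 0 -> (lead_mon le g <= m)%MM -> ideal (lead_terms le S) (c *: 'X_[m]).
Proof.
move=> leT Sg g0 /submK <-.
have -> : c *: 'X_[m - lead_mon le g + lead_mon le g] =
    ((c / lead_cf le g) *: 'X_[m - lead_mon le g]) * lead_term le g.
  rewrite /lead_term -scalerAl -scalerAr scalerA mpolyXD divfK //.
  exact: lead_cf_neq0.
by apply/idealM/ideal_sub; exists g.
Qed.

(** Ideals of leading terms are monomial, so comparing them comes down to divisibility of leading
    monomials; one inclusion is immediate from [G] lying in [I]. *)
Lemma groebnerP le I G : term_order le -> (forall g, g \in G -> I g) ->
  groebner le I G <-> forall p, I p -> p != 0 ->
    exists g, [/\ g \in G, g != 0 & (lead_mon le g <= lead_mon le p)%MM].
Proof.
move=> leT GI; split=> [[_ lt_eq] p Ip p0|dvd].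
  have: ideal (lead_terms le I) (lead_term le p) by apply: ideal_sub; exists p.
  move/lt_eq/ideal_lead_terms_dvd; apply.
  by rewrite mcoeff_msupp mcoeffZ mcoeffX eqxx mulr1 lead_cf_neq0.
split=> // p; split; apply: ideal_mono => _ [g [Sg g0 ->]].
  by apply: ideal_sub; exists g; split=> //; apply: GI.
by have [g' [Gg' g'0]] := dvd g Sg g0; apply: ideal_lead_terms_intro.
Qed.

(** [groebner] speaks of leading terms only, so generation has to be derived by division:
    subtracting [t * g] cancels the leading term of [p], and the induction follows the well-founded
    term order. *)
Lemma groebner_generates le S G : term_order le -> groebner le (ideal S) G ->
  forall p, ideal_of G p <-> ideal S p.
Proof.
move=> leT gb p; split; first by apply: ideal_mono => g /gb.1.
have /(groebnerP leT gb.1) dvd := gb.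
move: {2}(lead_mon le p) (erefl (lead_mon le p)) => m; elim/(well_founded_ind (term_order_wf leT)): m p.
move=> m IH p em Ip; have [->|p0] := eqVneq p 0; first exact: ideal0.
have [g [Gg g0 gm]] := dvd p Ip p0.
pose t := (lead_cf le p / lead_cf le g) *: 'X_[lead_mon le p - lead_mon le g].
have Ggt : ideal_of G (t * g) by apply/idealM/ideal_sub.
rewrite -[p](subrK (t * g)); apply: idealD => //.
have Iq : ideal S (p - t * g) by apply: idealB => //; apply/idealM/gb.1.
have [->|q0] := eqVneq (p - t * g) 0; first exact: ideal0.
apply: (IH (lead_mon le (p - t * g))) => //.
have le_t m' : m' \in msupp (t * g) -> le m' m.
  rewrite /t -scalerAl => /msuppZ_le; rewrite mulrC (perm_mem (msuppMX _ _)).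
  move=> /mapP[m'' m''g ->]; rewrite -em -{2}(submK gm) addmC.
  by rewrite [X in le _ X]addmC; apply/(term_order_add2r leT)/lead_mon_max.
have := lead_mon_supp leT q0; set m' := lead_mon _ _ => m'q; apply/andP; split.
  have := m'q; move/(msuppD_le (p := p)); rewrite mem_cat => /orP[|].
    by rewrite -em; apply: lead_mon_max.
  by rewrite (perm_mem (msuppN _)); apply: le_t.
(* The factor in [t] is chosen so that the coefficient at the old leading monomial cancels; the new
   leading monomial therefore differs from it. *)
apply/eqP => e; move: m'q; rewrite mcoeff_msupp e -em mcoeffB /t -scalerAl mcoeffZ.
have -> : ('X_[lead_mon le p - lead_mon le g] * g)@_(lead_mon le p) = lead_cf le g.
  by rewrite mulrC -{1}(submK gm) mcoeffMX.
by rewrite divfK ?lead_cf_neq0 // subrr eqxx.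
Qed.

Lemma eq_reduced_groebner le le' I I' G : le =2 le' -> (forall p, I p <-> I' p) ->
  reduced_groebner le I G -> reduced_groebner le' I' G.
Proof.
move=> ele eI.
have elm := fun p => eq_lead_mon p ele.
have elt S p : lead_terms le S p <-> lead_terms le' S p.
  by split=> -[q]; rewrite /lead_term /lead_cf -?elm ?elm => ?; exists q;
     rewrite /lead_term /lead_cf -?elm ?elm.
have eid S p : ideal (lead_terms le S) p <-> ideal (lead_terms le' S) p.
  by split; apply: ideal_mono => q /elt; apply: ideal_sub.
case=> -[GI gb] red; split; first split.
- by move=> g /GI/eI.
- move=> p; rewrite -eid gb eid; split; apply: ideal_mono => _ [q [Iq q0 ->]];
    by apply: ideal_sub; exists q; split=> //; apply/eI.
- move=> g /red[]; rewrite /lead_cf elm => ? nid; split=> // m /nid.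
  by move=> nid_m /eid.
Qed.

End Ideals.

(** * The lexicographic order *)

Lemma lexleP n (a b : 'X_{1..n}) :
  reflect (a = b \/ exists i : 'I_n, (a i < b i)%N /\ forall j : 'I_n, (j < i)%N -> a j = b j)
    (lexle a b).
Proof.
apply: (iffP orP) => -[e|lt]; [by left; apply/eqP | right | by left; apply/eqP | right].
  have [i /andP[lti /forallP eqi]] := existsP lt.
  by exists i; split=> // j ji; apply/eqP; apply: (implyP (eqi j)).
have [i [lti eqi]] := lt; apply/existsP; exists i; rewrite lti.
by apply/forallP => j; apply/implyP => /eqi ->.
Qed.

Lemma lexle_term_order n : term_order (@lexle n).
Proof.
(* The least index at which two exponent vectors differ decides their comparison. *)
have lex_total (a b : 'X_{1..n}) : a = b \/ exists i : 'I_n, a i != b i /\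
    forall j : 'I_n, (j < i)%N -> a j = b j.
  have [->|/eqP ne] := eqVneq a b; [by left | right].
  have [i0 nei0] : exists i, a i != b i.
    case: (pickP (fun i => a i != b i)) => [i nei|e]; first by exists i.
    by case: ne; apply/mnmP => i; apply/eqP/negPn/negbT/e.
  case: (@arg_minnP _ i0 (fun i => a i != b i) val nei0) => i nei min_i.
  exists i; split=> // j ji; apply/eqP/negPn/negP => /min_i /=.
  by rewrite leqNgt ji.
split.
- move=> a b; case: (lex_total a b) => [->|[i [ne eqi]]].
    by apply/orP; left; apply/lexleP; left.
  case: (ltngtP (a i) (b i)) ne => // lti _; apply/orP; [left|right]; apply/lexleP; right;
    by exists i; split=> // j /eqi.
- move=> a b /andP[/lexleP[//|[i [lti eqi]]] /lexleP[//|[j [ltj eqj]]]].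
  case: (ltngtP i j) => [/eqj e|/eqi e|/val_inj e].
  - by rewrite e ltnn in lti.
  - by rewrite e ltnn in ltj.
  - by rewrite e in lti; have := ltn_trans lti ltj; rewrite ltnn.
- move=> b a c /lexleP[->//|[i [lti eqi]]] /lexleP[<-|[j [ltj eqj]]]; apply/lexleP; right.
    by exists i.
  case: (ltngtP i j) => [ij|ji|/val_inj e].
  - exists i; rewrite -eqj //; split=> // l li; rewrite eqi // eqj //; exact: ltn_trans ij.
  - exists j; rewrite eqi //; split=> // l lj; rewrite eqi ?eqj //; exact: ltn_trans ji.
  - exists i; split; first by apply: ltn_trans lti _; rewrite e.
    by move=> l li; rewrite eqi // eqj // -e.
- move=> m; apply/lexleP; case: (lex_total 0%MM m) => [->|[i [ne eqi]]]; [by left | right].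
  by exists i; split=> //; rewrite mnm0E lt0n eq_sym -(mnm0E i).
- move=> a b m /lexleP[->|[i [lti eqi]]]; apply/lexleP; [by left | right].
  exists i; rewrite !mnmDE ltn_add2r; split=> // j /eqi e.
  by rewrite !mnmDE e.
Qed.

(** * Ideals generated by the entries of a column *)

Section ColumnIdeals.
Variables (k : fieldType) (n' : nat).
Local Notation R := {mpoly k[n'.+1]}.

Lemma entriesP s (v : 'cV[R]_s) x :
  reflect (exists i, x = v i 0) (x \in entries v).
Proof.
apply: (iffP idP) => [/imfsetP[i _ ->]|[i ->]]; first by exists i.
by apply/imfsetP; exists i.
Qed.

Lemma ideal_entriesP s (v : 'cV[R]_s) p :
  ideal_of (entries v) p <-> exists r : 'rV_s, p = (r *m v) 0 0.
Proof.
split=> [[c vc ->]|[r ->]]; last first.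
  by rewrite mxE; apply: ideal_sum => j; apply/idealM/ideal_sub/entriesP; exists j.
rewrite big_seq; elim/big_rec: _ => [|x _ xc [r ->]].
  by exists 0; rewrite mul0mx mxE.
have /entriesP[i ->] := vc x xc.
exists (x.1 *: delta_mx 0 i + r).
by rewrite mulmxDl -scalemxAl -rowE !mxE.
Qed.

(** Elements of such an ideal are row vectors times the column. Since [B] recovers [v] from
    [A *m v], row vectors translate in both directions. *)
Lemma ideal_entries_mulmx s t (A : 'M[R]_(s, t)) (B : 'M[R]_(t, s)) (v : 'cV[R]_t) p :
  B *m A = 1%:M -> ideal_of (entries (A *m v)) p <-> ideal_of (entries v) p.
Proof.
move=> BA; split=> /ideal_entriesP[r ->]; apply/ideal_entriesP.
  by exists (r *m A); rewrite mulmxA.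
by exists (r *m B); rewrite -mulmxA (mulmxA B) BA mul1mx.
Qed.

Lemma unitri_unit e s (U : 'M[R]_s) : unitri e U -> U \in unitmx.
Proof.
move=> triU; rewrite unitmxE -det_tr det_trig.
  rewrite big1 ?unitr1 // => i _; rewrite mxE.
  by have [_ ->] := triU i i.
apply/is_trig_mxP => i j ltij; rewrite mxE.
by have [->] := triU j i.
Qed.

(** This isolates a rectangular identity matrix as the only non-square factor of U_1 P U_2. *)
Lemma stackE s (U : 'M[R]_n'.+1) :
  stack s U = (\matrix_(i, j) (i == j :> nat)%:R) *m U.
Proof.
apply/matrixP => i j; rewrite !mxE; case: ifP => [lti|/negbT nlt].
  rewrite (bigD1 (inord i)) //= !mxE inordK // eqxx mul1r big1 ?addr0 // => l ne.
  rewrite mxE; case: eqP => [e|_]; last by rewrite mul0r.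
  by case/eqP: ne; apply: val_inj; rewrite /= inordK.
rewrite big1 // => l _; rewrite mxE; case: eqP => [e|_]; last by rewrite mul0r.
by rewrite e ltn_ord in nlt.
Qed.

(** The square factors are invertible and are undone in reverse order; the rectangular identity is
    undone by its transpose, because n <= s. *)
Lemma sample_matrix_left_inverse e s (U1 : 'M[R]_s) (P : 'S_s) (U2 : 'M[R]_n'.+1) :
  (n' < s)%N -> unitri e U1 -> unitri e U2 ->
  exists B, B *m (U1 *m (perm_mx P *m stack s U2)) = 1%:M.
Proof.
move=> ns /unitri_unit U1u /unitri_unit U2u.
exists (invmx U2 *m (\matrix_(i < n'.+1, j < s) (i == j :> nat)%:R)
        *m invmx (perm_mx P) *m invmx U1).
rewrite -!mulmxA (mulmxA (invmx U1)) mulVmx // mul1mx.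
rewrite (mulmxA (invmx _) (perm_mx P)) mulVmx ?unitmx_perm // mul1mx stackE.
rewrite (mulmxA (\matrix_(_, _) _)).
set E := (X in _ *m (X *m _)); suff -> : E = 1%:M by rewrite mul1mx mulVmx.
apply/matrixP => i j; rewrite !mxE (bigD1 (widen_ord ns i)) //= !mxE eqxx mul1r big1 ?addr0 //.
  by move=> l ne; rewrite !mxE; case: eqP => [e0|_]; [case/eqP: ne; apply: val_inj|rewrite mul0r].
Qed.

End ColumnIdeals.

(** * Shape sets: membership, the reduced lexicographic basis, dimension and cardinality *)

Section Shape.
Variables (k : fieldType) (n' : nat).
Local Notation n := n'.+1.
Local Notation R := {mpoly k[n]}.
Local Notation in_last := (in_last n').
Local Notation head_var := (head_var k).
Implicit Types (p : R) (q h : {poly k}) (g : 'I_n' -> {poly k}).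

Lemma in_lastE q : in_last q = \sum_(i < size q) q`_i *: 'X_[U_(ord_max) *+ i].
Proof.
rewrite /in_last -{1}[q]coefK poly_def linear_sum; apply: eq_bigr => i _ /=.
by rewrite linearZ /= rmorphXn /= horner_algX mpolyXn -scalerAl mul1r.
Qed.

Lemma mcoeff_in_last q m :
  (in_last q)@_m = (m == U_(ord_max) *+ m ord_max)%MM%:R * q`_(m ord_max).
Proof.
have mulU i : ((U_(ord_max) *+ i)%MM : 'X_{1..n}) ord_max = i.
  by rewrite mulmnE mnm1E eqxx mul1n.
rewrite in_lastE raddf_sum /=; case: eqP => [em|ne]; last first.
  rewrite mul0r big1 // => i _; rewrite mcoeffZ mcoeffX; case: eqP => [e|_].
    by case: ne; rewrite -e mulU.
  by rewrite mulr0.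
have [lt|ge] := ltnP (m ord_max) (size q).
  rewrite mul1r (bigD1 (Ordinal lt)) //= mcoeffZ mcoeffX -em eqxx mulr1 big1 ?addr0 //.
  move=> i ne; rewrite mcoeffZ mcoeffX; case: eqP => [e|_]; last by rewrite mulr0.
  by case/eqP: ne; apply: val_inj; rewrite /= -e mulU.
rewrite mul1r (nth_default _ ge) big1 // => i _; rewrite mcoeffZ mcoeffX.
case: eqP => [e|_]; last by rewrite mulr0.
by have := ltn_ord i; rewrite -(mulU i) e ltnNge ge.
Qed.

Lemma msupp_in_last q m : m \in msupp (in_last q) ->
  m = (U_(ord_max) *+ m ord_max)%MM /\ q`_(m ord_max) != 0.
Proof.
rewrite mcoeff_msupp mcoeff_in_last; have [em|_] := eqVneq m; last by rewrite mul0r eqxx.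
by rewrite mul1r.
Qed.

(** The substitution x_j = g_j for j < n, with x_n sent to the variable of k[X]. *)
Definition shape_eval g : R -> {poly k} :=
  mmap polyC (fun i => if unlift ord_max i is Some j then g j else 'X).

HB.instance Definition _ g := GRing.RMorphism.copy (shape_eval g) (shape_eval g).

Lemma shape_evalX g j : shape_eval g (head_var j) = g j.
Proof.
rewrite /shape_eval mmapX mmap1U.
suff -> : widen_ord (leqnSn n') j = lift ord_max j by rewrite liftK.
by apply: val_inj; rewrite /= /bump leqNgt ltn_ord.
Qed.

Lemma shape_eval_in_last g q : shape_eval g (in_last q) = q.
Proof.
rewrite in_lastE /shape_eval raddf_sum /= -[RHS]coefK poly_def; apply: eq_bigr => i _.
by rewrite mmapZ -mpolyXn rmorphXn /= mmapX mmap1U unlift_none mul_polyC.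
Qed.

Lemma shape_setP h g p : reflect
  (p = in_last h \/ exists j, p = head_var j - in_last (g j)) (p \in shape_set h g).
Proof.
apply: (iffP (entriesP _ _)) => [[i ->]|[->|[j ->]]]; rewrite /shape_col.
- rewrite mxE; case: unliftP => [j _|_]; [right | left] => //; by exists j.
- by exists ord0; rewrite mxE unlift_none.
- by exists (lift ord0 j); rewrite mxE liftK.
Qed.

(** The polynomials satisfying this congruence include the constants and the variables, and they are
    closed under products and linear combinations. *)
Lemma sub_in_last_shape_eval h g p :
  ideal_of (shape_set h g) (p - in_last (shape_eval g p)).
Proof.
set I := ideal_of _.
have in_lastM q q' : in_last (q * q') = in_last q * in_last q' by rewrite /in_last rmorphM.
have subM p1 p2 : I (p1 - in_last (shape_eval g p1)) -> I (p2 - in_last (shape_eval g p2)) ->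
    I (p1 * p2 - in_last (shape_eval g (p1 * p2))).
  move=> I1 I2; rewrite rmorphM in_lastM.
  rewrite -[p1 * p2](subrK (p1 * in_last (shape_eval g p2))) -addrA -mulrBr -mulrBl.
  by apply: idealD; [|rewrite mulrC]; apply: idealM.
have I1 : I (1 - in_last (shape_eval g 1)).
  by rewrite rmorph1 /in_last rmorph1 subrr; apply: ideal0.
have IX i : I ('X_i - in_last (shape_eval g 'X_i)).
  rewrite /shape_eval mmapX mmap1U; case: unliftP => [j ->|->].
    apply/ideal_sub/shape_setP; right; exists j; congr ('X_ _ - _); apply: val_inj.
    by rewrite /= /bump leqNgt ltn_ord.
  by rewrite /in_last horner_algX subrr; apply: ideal0.
elim/mpolyind: p => [|c m p _ _ IHp].
  by rewrite rmorph0 /in_last rmorph0 subrr; apply: ideal0.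
have -> : shape_eval g (c *: 'X_[m] + p) = c *: shape_eval g 'X_[m] + shape_eval g p.
  by rewrite rmorphD /=; congr (_ + _); rewrite /shape_eval mmapZ mul_polyC.
have -> q q' : in_last (c *: q + q') = c *: in_last q + in_last q'.
  by rewrite /in_last rmorphD /= linearZ /= -scalerAl mul1r.
rewrite opprD addrACA -scalerBr; apply: idealD => //; apply: idealZ.
rewrite mpolyXE_id; elim/big_rec: _ => [|i q _ IHq]; first exact: I1.
apply: (subM); last exact: IHq.
elim: (m i) => [|e IHe]; first by rewrite expr0; exact: I1.
by rewrite exprS; apply: (subM); [exact: IX | exact: IHe].
Qed.

(** [shape_eval] identifies the quotient by the ideal with k[X]/(h), which turns membership into a
    univariate divisibility test. *)
Lemma ideal_shape_setP h g p : ideal_of (shape_set h g) p <-> h %| shape_eval g p.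
Proof.
split=> [[c cG ->]|/dvdpP[q e]].
  rewrite rmorph_sum big_seq /=; elim/big_rec: _ => [|x q xc hq]; first exact: dvdp0.
  apply: dvdp_add => //; rewrite rmorphM /= dvdp_mull //.
  case/shape_setP: (cG x xc) => [->|[j ->]]; first by rewrite shape_eval_in_last.
  by rewrite rmorphB /= shape_evalX shape_eval_in_last subrr dvdp0.
rewrite -[p](subrK (in_last (shape_eval g p))); apply: idealD.
  exact: sub_in_last_shape_eval.
rewrite e /in_last rmorphM; apply/idealM/ideal_sub/shape_setP.
by left.
Qed.

Section ShapeGroebner.
Variables (h : {poly k}) (g : 'I_n' -> {poly k}).
Hypotheses (h_monic : h \is monic) (h_size : (1 < size h)%N).
Hypothesis g_size : forall j, (size (g j) <= (size h).-1)%N.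

Let D := (size h).-1.
Let G := shape_set h g.

Let leT := lexle_term_order n.

Local Notation powX i := (U_(@ord_max n') *+ i)%MM.
Let powX_max i : powX i ord_max = i.
Proof. by rewrite mulmnE mnm1E eqxx mul1n. Qed.

Let powX_head i (j : 'I_n) : (j < n')%N -> powX i j = 0%N.
Proof.
move=> jn; rewrite mulmnE mnm1E; case: eqP => [e|_]; last by rewrite mul0n.
by rewrite -e ltnn in jn.
Qed.

Local Notation headm j := U_(widen_ord (leqnSn n') j)%MM.

Lemma lead_mon_shape_h : lead_mon (@lexle n) (in_last h) = powX D.
Proof.
apply: lead_mon_eq => //.
  rewrite mcoeff_msupp mcoeff_in_last powX_max eqxx mul1r.
  by move/monicP: h_monic; rewrite /lead_coef -/D => ->; apply: oner_neq0.
move=> m /msupp_in_last[em nz]; rewrite em; apply: (term_order_dvd leT); apply/mnm_lepP => i.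
rewrite !mulmnE leq_mul2l; apply/orP; right.
rewrite /D -ltnS prednK; last exact: ltnW.
by rewrite ltnNge; apply: contra nz => /(nth_default 0) ->.
Qed.

Lemma mcoeff_shape_g j m : (head_var j - in_last (g j))@_m =
  (headm j == m)%:R - (m == powX (m ord_max))%:R * (g j)`_(m ord_max).
Proof. by rewrite mcoeffB mcoeffX mcoeff_in_last. Qed.

Lemma msupp_shape_g j m : m \in msupp (head_var j - in_last (g j)) ->
  m = headm j \/ m = powX (m ord_max) /\ (m ord_max < D)%N.
Proof.
rewrite mcoeff_msupp mcoeff_shape_g; have [->|_] := eqVneq (headm j) m; first by left.
have [em|_] := eqVneq m (powX (m ord_max)); last by rewrite mul0r subrr eqxx.
rewrite sub0r mul1r oppr_eq0 => nz; right; split=> //.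
apply: leq_trans (g_size j).
by rewrite ltnNge; apply: contra nz => /(nth_default 0) ->.
Qed.

Let headm_max j : headm j ord_max = 0%N.
Proof.
rewrite mnm1E; case: eqP => // /(congr1 val) /= e.
by have := ltn_ord j; rewrite e ltnn.
Qed.

Let headm_neq j i : headm j != powX i.
Proof.
apply/eqP => /mnmP/(_ (widen_ord (leqnSn n') j)).
by rewrite mnm1E eqxx (@powX_head i (widen_ord (leqnSn n') j) (ltn_ord j)).
Qed.

Lemma lead_cf_shape_g j : (head_var j - in_last (g j))@_(headm j) = 1.
Proof. by rewrite mcoeff_shape_g eqxx (negPf (headm_neq _ _)) mul0r subr0. Qed.

Lemma lead_mon_shape_g j : lead_mon (@lexle n) (head_var j - in_last (g j)) = headm j.
Proof.
apply: lead_mon_eq => //.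
  by rewrite mcoeff_msupp lead_cf_shape_g oner_neq0.
move=> m /msupp_shape_g[->|[-> _]]; first exact: term_order_refl.
apply/lexleP; right; exists (widen_ord (leqnSn n') j); split.
  by rewrite powX_head //= mnm1E eqxx.
move=> i ij; rewrite powX_head; last exact: (ltn_trans ij (ltn_ord j)).
rewrite mnm1E; case: eqP => // /(congr1 val) /= e.
by move: ij; rewrite /= e ltnn.
Qed.

Lemma shape_set_reduced_groebner : reduced_groebner (@lexle n) (ideal_of G) G.
Proof.
have h0 : h != 0 by rewrite -size_poly_eq0 -lt0n ltnW.
have GI f : f \in G -> ideal_of G f by move=> Gf; apply: ideal_sub.
split.
  apply/groebnerP => // p /ideal_shape_setP hp p0.
  have := lead_mon_supp leT p0; set m := lead_mon _ p => mp.
  (* If some x_j with j < n divides [m], then the leading monomial of x_j - g_j does. *)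
  case: (pickP (fun j : 'I_n' => m (widen_ord (leqnSn n') j) != 0%N)) => [j mj|m_last].
    exists (head_var j - in_last (g j)); rewrite lead_mon_shape_g lep1mP mj; split=> //.
      by apply/shape_setP; right; exists j.
    by apply/eqP => e; have := lead_cf_shape_g j; rewrite e mcoeff0 => /eqP; rewrite eq_sym oner_eq0.
  (* Otherwise [m] is a power of x_n, and a lexicographically smaller monomial cannot contain an
     earlier variable either. *)
  have p_last m' : m' \in msupp p -> m' = powX (m' ord_max).
    move=> /(lead_mon_max leT) /lexleP lem'; apply/mnmP => i.
    have mi (l : 'I_n) : (l < n')%N -> m l = 0%N.
      move=> ln; have := m_last (Ordinal ln) => /negbT/negPn/eqP <-; congr (m _).
      exact: val_inj.
    have [ln|] := ltnP i n'; last first.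
      move=> ni; suff -> : i = ord_max by rewrite powX_max.
      by apply: val_inj; apply/eqP; rewrite eqn_leq -ltnS ltn_ord.
    rewrite powX_head //; case: lem' => [->|[l [ltl eql]]]; first exact: mi.
    have [il|li] := ltnP i l; first by rewrite eql ?mi.
    by rewrite -/m mi // in ltl; apply: leq_ltn_trans ln.
  (* [p] is [q] read in x_n, so [shape_eval] returns [q]. Then [h] divides [q], and deg h is at most
     the exponent of x_n in [m]. *)
  pose q := \poly_(i < (m ord_max).+1) p@_(powX i).
  have pq : p = in_last q.
    apply/mpolyP => m'; rewrite mcoeff_in_last coef_poly.
    have [m'p|m'p] := boolP (m' \in msupp p); last first.
      rewrite memN_msupp_eq0 //; case: eqP => [e|_]; last by rewrite mul0r.
      by rewrite -e memN_msupp_eq0 // if_same mulr0.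
    rewrite -p_last // eqxx mul1r ltnS.
    suff -> : (m' ord_max <= m ord_max)%N by [].
    have em' := p_last m' m'p; have em := p_last m mp.
    rewrite leqNgt; apply/negP => lt; have := lead_mon_max leT m'p.
    rewrite -/m => le1; have le2 : lexle m m'.
      rewrite em em'; apply: (term_order_dvd leT); apply/mnm_lepP => i.
      by rewrite !mulmnE leq_mul2l (ltnW lt) orbT.
    by have e := term_order_anti leT le1 le2; rewrite e ltnn in lt.
  exists (in_last h); rewrite lead_mon_shape_h; split.
  - by apply/shape_setP; left.
  - by apply/eqP => e; have := shape_eval_in_last g h; rewrite e rmorph0 => e0; rewrite -e0 eqxx in h0.
  move: hp; rewrite pq shape_eval_in_last => hq.
  have q0 : q != 0 by apply/eqP => e; rewrite pq e /in_last rmorph0 eqxx in p0.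
  have := dvdp_leq q0 hq => le_hq.
  rewrite (p_last m mp); apply/mnm_lepP => i; rewrite !mulmnE leq_mul2l; apply/orP; right.
  rewrite /D -ltnS prednK; last exact: ltnW.
  exact: leq_trans le_hq (size_poly _ _).
(* Reducedness: the power of x_n with exponent deg h > 0 divides neither x_j nor the lower powers
   occurring in g_j, and x_j divides no monomial of another element. *)
have not_dvd f m : f \in G -> m \in msupp f ->
    forall f', f' \in G -> f' != f -> (lead_mon (@lexle n) f' <= m)%MM = false.
  move=> /shape_setP Gf mf f' /shape_setP Gf' ne.
  case: Gf mf ne => [->|[j ->]] mf ne; case: Gf' ne => [->|[j' ->]] ne.
  - by rewrite eqxx in ne.
  - rewrite lead_mon_shape_g lep1mP; have [-> _] := msupp_in_last mf.
    by rewrite powX_head ?eqxx //=.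
  - rewrite lead_mon_shape_h; apply/negbTE/negP => /mnm_lepP/(_ ord_max); rewrite powX_max.
    case: (msupp_shape_g mf) => [->|[_ lt]]; last by rewrite leqNgt lt.
    by rewrite headm_max leqNgt /D -ltnS prednK ?h_size // ltnW.
  - rewrite lead_mon_shape_g lep1mP; case: (msupp_shape_g mf) => [->|[-> _]].
      rewrite mnm1E; have [/(congr1 val) /= e|//] := eqVneq (widen_ord (leqnSn n') j) _.
      by case/eqP: ne; rewrite (val_inj e).
    by rewrite powX_head ?eqxx //=.
move=> f Gf; split.
  case/shape_setP: Gf => [->|[j ->]]; rewrite /lead_cf.
    rewrite lead_mon_shape_h mcoeff_in_last powX_max eqxx mul1r.
    by move/monicP: h_monic.
  by rewrite lead_mon_shape_g lead_cf_shape_g.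
move=> m mf /(ideal_lead_terms_dvd (m := m))[].
  by rewrite msuppMCX ?mem_head // -mcoeff_msupp.
move=> f' [/fsetD1P[ne Gf'] _]; by rewrite (not_dvd f).
Qed.

Lemma zero_dim_shape_set : zero_dim (ideal_of G).
Proof.
pose b (i : 'I_D) : R := 'X_[powX i].
have b_inj : injective b.
  move=> i i' /(congr1 (fun p : R => p@_(powX i))); rewrite !mcoeffX eqxx.
  case: eqP => [/(congr1 (fun m : 'X_{1..n} => m ord_max))|_ /eqP]; last by rewrite oner_eq0.
  by rewrite !powX_max => /val_inj ->.
exists [seq b i | i <- enum 'I_D] => p.
pose q := shape_eval g p %% h.
(* [zero_dim] indexes the coefficients by the spanning polynomials themselves, so the exponent of a
   power of x_n is recovered as its total degree. *)
exists (fun f => q`_(msize f).-1).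
rewrite big_map big_enum /=.
have -> : \sum_(i < D) q`_(msize (b i)).-1 *: b i = in_last q.
  rewrite in_lastE; have qD : (size q <= D)%N.
    by rewrite -ltnS /D prednK ?ltn_modp -?size_poly_eq0 -?lt0n ltnW.
  have -> : \sum_(i < D) q`_(msize (b i)).-1 *: b i = \sum_(i < D) q`_i *: 'X_[powX i].
    by apply: eq_bigr => i _; rewrite /b msizeX mdegMn mdeg1 mul1n.
  rewrite (big_ord_widen D (fun i => q`_i *: 'X_[powX i]) qD) [RHS]big_mkcond.
  apply: eq_bigr => i _; case: ltnP => // ge.
  by rewrite (nth_default 0 ge) scale0r.
apply/ideal_shape_setP; rewrite rmorphB /= shape_eval_in_last.
by rewrite {1}(divp_eq (shape_eval g p) h) addrK dvdp_mull.
Qed.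

(** The coefficient at x_j is 1 in x_j - g_j and 0 in every other entry, so the entries are
    distinct. *)
Lemma card_shape_set : #|` G| = n.
Proof.
have head_in_last q j : (in_last q)@_(headm j) = 0.
  by rewrite mcoeff_in_last (negPf (headm_neq _ _)) mul0r.
rewrite card_imfset /=; first exact: size_enum_ord.
move=> i i'; rewrite !mxE; case: unliftP => [j ->|->]; case: unliftP => [j' ->|->] //.
- move=> /(congr1 (mcoeff (headm j'))); rewrite lead_cf_shape_g mcoeffB head_in_last subr0.
  rewrite mcoeffX eq_mnm1; have [/(congr1 val) /= e _|_ /eqP] :=
    eqVneq (widen_ord (leqnSn n') j) (widen_ord _ j').
    by rewrite (val_inj e).
  by rewrite eq_sym oner_eq0.
- move=> /(congr1 (mcoeff (headm j))); rewrite lead_cf_shape_g head_in_last => /eqP.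
  by rewrite oner_eq0.
- move=> /(congr1 (mcoeff (headm j'))); rewrite lead_cf_shape_g head_in_last => /eqP.
  by rewrite eq_sym oner_eq0.
Qed.

End ShapeGroebner.

End Shape.

Lemma card_entries (k : fieldType) n' s (v : 'cV[{mpoly k[n'.+1]}]_s) : (#|` entries v| <= s)%N.
Proof. by apply: leq_trans (leq_imfset_card _ _ _) _; rewrite /= size_enum_ord. Qed.

(** * Cost of one pass of the loop *)

Section Cost.
Variables (k : fieldType) (n' c0 : nat) (K : costs).
Local Notation n := n'.+1.
Local Notation R := {mpoly k[n]}.
Hypothesis K_adm : admissible c0 K.
Implicit Types p q : R.

Lemma tdegD p q : (tdeg (p + q) <= maxn (tdeg p) (tdeg q))%N.
Proof. by have := msizeD_le p q; rewrite /tdeg; lia. Qed.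

Lemma tdegM p q : (tdeg (p * q) <= tdeg p + tdeg q)%N.
Proof.
have [->|p0] := eqVneq p 0; first by rewrite mul0r /tdeg msize0.
have [->|q0] := eqVneq q 0; first by rewrite mulr0 /tdeg msize0.
by rewrite /tdeg msizeM //; move: (msize p) (msize q) => a b; lia.
Qed.

Lemma tdeg_sum (J : Type) (r : seq J) (F : J -> R) e :
  (forall j, tdeg (F j) <= e)%N -> (tdeg (\sum_(j <- r) F j) <= e)%N.
Proof.
move=> Fe; elim/big_rec: _ => [|j p _ pe]; first by rewrite /tdeg msize0.
by apply: leq_trans (tdegD _ _) _; rewrite geq_max Fe.
Qed.

Lemma tdeg_mulmx a b (A : 'M[R]_(a, b)) (v : 'cV[R]_b) e :
  (forall i j, tdeg (A i j) + tdeg (v j 0%R) <= e)%N ->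
  forall i, (tdeg ((A *m v) i 0%R) <= e)%N.
Proof.
move=> Ae i; rewrite mxE; apply: tdeg_sum => j.
exact: leq_trans (tdegM _ _) (Ae i j).
Qed.

Lemma tdeg_in_last (q : {poly k}) e : (size q <= e.+1)%N -> (tdeg (in_last n' q : R) <= e)%N.
Proof.
move=> qe; rewrite in_lastE; apply: tdeg_sum => i.
rewrite /tdeg; have := msizeZ_le ('X_[U_(@ord_max n') *+ i] : R) q`_i.
rewrite msizeX mdegMn mdeg1 mul1n; have := ltn_ord i; move: (msize _) => a; lia.
Qed.

Let fold_mulmx a b (A : 'M[R]_(a, b)) (v : 'cV[R]_b) i acc (r : seq 'I_b) :=
  fold_timed (fun acc j => bind (mul_timed K (A i j) (v j 0%R)) (fun t => add_timed K acc t)) acc r.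

Lemma fold_mulmxE a b (A : 'M[R]_(a, b)) (v : 'cV[R]_b) i acc r :
  (fold_mulmx A v i acc r).1 = acc + \sum_(j <- r) A i j * v j 0.
Proof.
elim: r acc => [|j r IHr] acc /=; first by rewrite big_nil addr0.
by rewrite IHr big_cons addrA.
Qed.

Lemma mulmx_timedE a b (A : 'M[R]_(a, b)) (v : 'cV[R]_b) : (mulmx_timed K A v).1 = A *m v.
Proof.
apply/matrixP => i j; rewrite ord1 !mxE.
by apply: etrans (fold_mulmxE A v i 0 (enum 'I_b)) _; rewrite add0r big_enum.
Qed.

(** Each position takes a product and an addition, and an addition costs at most [c0] products:
    hence [c0.+1]. Bounding the sum of the two degrees by [e] controls the factors, their product
    and the accumulator at once. *)
Lemma fold_mulmx_cost a b (A : 'M[R]_(a, b)) (v : 'cV[R]_b) i acc r e :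
  (forall j, tdeg (A i j) + tdeg (v j 0%R) <= e)%N -> (tdeg acc <= e)%N ->
  ((fold_mulmx A v i acc r).2 <= size r * (c0.+1 * cost_mul K n e))%N.
Proof.
have [_ _ mul_homo add_le _] := K_adm.
move=> Ae; elim: r acc => [//|j r IHr] acc acc_e /=.
have tj : (tdeg (A i j * v j 0)%R <= e)%N by apply: leq_trans (tdegM _ _) (Ae j).
have le_acc : (maxn (tdeg acc) (tdeg (A i j * v j 0%R)%R) <= e)%N by rewrite geq_max acc_e.
have le_mul : (maxn (tdeg (A i j)) (tdeg (v j 0%R)) <= e)%N.
  by apply: leq_trans (Ae j); rewrite geq_max leq_addr leq_addl.
have m1 := mul_homo n _ _ le_mul.
have m2 := leq_trans (add_le n _) (leq_mul (leqnn c0) (mul_homo n _ _ le_acc)).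
have := IHr (acc + A i j * v j 0) (leq_trans (tdegD _ _) le_acc).
rewrite mulSn; move: m1 m2; rewrite !mulSn.
move: (cost_mul K n _) (cost_mul K n _) (cost_add K n _) => M1 M2 A1 H1 H2.
rewrite /fold_mulmx /=; lia.
Qed.

Lemma mulmx_timed_cost a b (A : 'M[R]_(a, b)) (v : 'cV[R]_b) e :
  (forall i j, tdeg (A i j) + tdeg (v j 0%R) <= e)%N ->
  ((mulmx_timed K A v).2 <= a * b * (c0.+1 * cost_mul K n e))%N.
Proof.
move=> Ae; rewrite /mulmx_timed /= addn0 -mulnA.
rewrite -[X in (_ <= X * _)%N](card_ord a) -sum_nat_const leq_sum // => i _.
rewrite -[X in (_ <= X * _)%N](size_enum_ord b); apply: fold_mulmx_cost => //.
by rewrite /tdeg msize0.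
Qed.

Lemma shape_timedE h (g : 'I_n' -> {poly k}) : (shape_timed K h g).1 = shape_col h g.
Proof. by apply/matrixP => i j; rewrite !mxE; case: unlift. Qed.

Lemma tdeg_head_var j : tdeg (head_var k j : R) = 1%N.
Proof. by rewrite /tdeg msizeX mdeg1. Qed.

Section Iteration.
Variables (le : rel 'X_{1..n}) (fglm : {fset R} -> timed {fset R}).
Variables (d d' smax s : nat) (x : sample k n' s).
Hypotheses (d_gt0 : (0 < d)%N) (x_valid : valid_sample d d' smax x).

Let v := smp_U1 x *m (perm_mx (smp_P x) *m (stack s (smp_U2 x) *m shape_col (smp_h x) (smp_g x))).
Let G := shape_set (smp_h x) (smp_g x).

Lemma tdeg_shape_col i : (tdeg (shape_col (smp_h x) (smp_g x) i 0%R) <= d)%N.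
Proof.
have [[_ /andP[_ h_le]] g_le _ _ _] := x_valid.
rewrite mxE; case: unlift => [j|]; last by apply: tdeg_in_last.
apply: leq_trans (tdegD _ _) _; rewrite tdeg_head_var geq_max d_gt0 /=.
rewrite /tdeg msizeN; apply: tdeg_in_last; have := g_le j; lia.
Qed.

Lemma tdeg_unitri r (U : 'M[R]_r) i j : unitri d' U -> (tdeg (U i j) <= d')%N.
Proof. by move=> /(_ i j)[_ _]; rewrite /tdeg; lia. Qed.

Lemma shape_timed_cost :
  ((shape_timed K (smp_h x) (smp_g x)).2 <= n' * (c0 * cost_mul K n (2 * d' + d)))%N.
Proof.
have [_ _ mul_homo add_le _] := K_adm.
have [[_ /andP[_ h_le]] g_le _ _ _] := x_valid.
rewrite /shape_timed /= addn0 -[X in (_ <= X * _)%N](card_ord n') -sum_nat_const.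
apply: leq_sum => j _; apply: leq_trans (add_le n _) _; rewrite leq_mul2l mul_homo ?orbT //.
rewrite tdeg_head_var geq_max addn_gt0 d_gt0 orbT /=.
by apply: tdeg_in_last; have := g_le j; lia.
Qed.

Local Opaque mulmx_timed shape_timed.

Lemma iterationE : (iteration K le fglm d d' x).1 =
  (entries v, if excluded_middle_informative (le =2 @lexle n) then G else (fglm G).1).
Proof.
rewrite /iteration /=; rewrite !mulmx_timedE shape_timedE /=.
by case: excluded_middle_informative.
Qed.

Lemma iteration_cost (e : nat) : (~ (le =2 @lexle n) -> (fglm G).2 <= e)%N ->
  ((iteration K le fglm d d' x).2 <=
     3 * c0.+1 * (n * cost_sample K 1 d + s ^ 2 * cost_sample K n d'
                  + (n ^ 2 + s ^ 2) * cost_mul K n (2 * d' + d))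
     + (if excluded_middle_informative (le =2 @lexle n) then 0 else e))%N.
Proof.
move=> fglm_e.
have [smp_homo smp_gt0 mul_homo _ [int_le perm_le]] := K_adm.
have [[_ /andP[_ h_le]] _ /andP[ns _] triU1 triU2] := x_valid.
pose G0 := shape_col (smp_h x) (smp_g x).
pose E := (2 * d' + d)%N.
have deg_stack i j : (tdeg (stack s (smp_U2 x) i j) <= d')%N.
  by rewrite mxE; case: ifP => _; [exact: tdeg_unitri | rewrite /tdeg msize0].
have deg1 i j : (tdeg (stack s (smp_U2 x) i j) + tdeg (G0 j 0%R) <= d' + d)%N.
  by apply: leq_add => //; exact: tdeg_shape_col.
have deg2 (i j : 'I_s) :
    (tdeg (perm_mx (smp_P x) i j : R) + tdeg ((stack s (smp_U2 x) *m G0)%R j 0%R) <= d' + d)%N.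
  have -> : perm_mx (smp_P x) i j = (smp_P x i == j)%:R :> R by rewrite !mxE.
  have -> : tdeg ((smp_P x i == j)%:R : R) = 0%N.
    by case: eqP => _; rewrite /tdeg ?msize0 ?msize1.
  exact: tdeg_mulmx deg1 j.
have deg3 i j : (tdeg (smp_U1 x i j) +
    tdeg ((perm_mx (smp_P x) *m (stack s (smp_U2 x) *m G0))%R j 0%R) <= E)%N.
  have -> : E = (d' + (d' + d))%N by rewrite /E mul2n -addnn addnA.
  by apply: leq_add; [exact: tdeg_unitri | exact: tdeg_mulmx deg2 j].
have leE : (d' + d <= E)%N by rewrite leq_add2r leq_pmull.
(* Each of the three matrix-vector products has at most s^2 positions, since n <= s, and works in
   degree at most [E]. *)
have le_cost X (a b : nat) : (b <= s)%N -> (X <= s * b * (c0.+1 * cost_mul K n a))%N -> (a <= E)%N ->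
    (X <= c0.+1 * (s ^ 2 * cost_mul K n E))%N.
  move=> bs X_le aE; apply: leq_trans X_le _; rewrite mulnCA leq_mul2l; apply/orP; right.
  by rewrite leq_mul ?mul_homo // leq_mul2l bs orbT.
have c1 := le_cost _ _ _ ns (mulmx_timed_cost deg1) leE.
have c2 := le_cost _ _ _ (leqnn s) (mulmx_timed_cost deg2) leE.
have c3 := le_cost _ _ _ (leqnn s) (mulmx_timed_cost deg3) (leqnn E).
have c4 : (\sum_(j < n') cost_sample K 1 (size (smp_h x)).-2 <= n' * cost_sample K 1 d)%N.
  rewrite -[X in (_ <= X * _)%N](card_ord n') -sum_nat_const.
  by apply: leq_sum => j _; apply: smp_homo; lia.
have c5 := shape_timed_cost; have c6 := perm_le s.
have binl r : (r <= s)%N -> ('C(r, 2) * cost_sample K n d' <= s ^ 2 * cost_sample K n d')%N.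
  move=> rs; rewrite leq_mul2r; apply/orP; right; rewrite bin2; have := leq_mul rs rs.
  by nia.
have c7 := binl _ (leqnn s); have c8 := binl _ ns.
have c9 : ((if excluded_middle_informative (le =2 @lexle n) then ret (entries G0)
     else fglm (entries G0)).2 <= if excluded_middle_informative (le =2 @lexle n) then 0 else e)%N.
  by case: excluded_middle_informative => // nle; apply: fglm_e.
rewrite /iteration /= !mulmx_timedE shape_timedE.
have total := leq_add (leqnn (cost_sample K 1 d)) (leq_add c4 (leq_add c5 (leq_add int_le
  (leq_add c7 (leq_add c8 (leq_add c6 (leq_add c1 (leq_add c2 (leq_add c3
  (leq_add c9 (leqnn 0))))))))))).
apply: leq_trans total _; rewrite -/E.
(* Sampling costs are positive, so the costs of drawing s and P, at most [c0] and [c0 * s ^ 2], are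
   absorbed into the sampling terms. *)
have s1 := smp_gt0 1%N d; have s2 := smp_gt0 n d'.
move: (cost_sample K 1 d) (cost_sample K n d') (cost_mul K n E) s1 s2 => S1 S2 M s1 s2.
have b1 : (c0 <= c0.+1 * (n * S1))%N by nia.
have b2 : (S1 + n' * S1 <= c0.+1 * (n * S1))%N by nia.
have b3 : (n' * (c0 * M) <= c0.+1 * (n ^ 2 * M))%N.
  have : (n' * (c0 * M) <= n * (c0.+1 * M))%N by rewrite leq_mul // leq_mul.
  move/leq_trans; apply; rewrite mulnCA leq_mul2l; apply/orP; right.
  by rewrite leq_mul2r; apply/orP; right; rewrite -[X in (X <= _)%N]expn1 leq_pexp2l.
have b4 : (s ^ 2 * S2 <= c0.+1 * (s ^ 2 * S2))%N by rewrite leq_pmull.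
have b5 : (c0 * s ^ 2 <= c0.+1 * (s ^ 2 * S2))%N by rewrite leq_mul // leq_pmulr.
move: (s ^ 2 * S2)%N b1 b2 b3 b4 b5 => Y b1 b2 b3 b4 b5.
rewrite (mulnDl _ _ M).
move: (n * S1)%N (n ^ 2 * M)%N (s ^ 2 * M)%N b1 b2 b3 => X N W b1 b2 b3.
move: (if _ then _ else _)%N => e'; lia.
Qed.

End Iteration.
End Cost.

(** * Counting and polynomial functions on the parameter space *)

Section ParameterSpace.
Variables (k : fieldType) (T : finType).
Implicit Types (v : T -> k) (f : (T -> k) -> k) (B : (T -> k) -> bool) (t : T).

Definition upd v t (a : k) : T -> k := fun t' => if t' == t then a else v t'.

Lemma upd_same v t a : upd v t a t = a.
Proof. by rewrite /upd eqxx. Qed.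

Lemma upd_other v t a t' : t' != t -> upd v t a t' = v t'.
Proof. by rewrite /upd => /negPf ->. Qed.

Lemma upd_id v t : upd v t (v t) = v.
Proof. by apply: functional_extensionality => t'; rewrite /upd; case: eqP => [->|]. Qed.

(** This extends [rare] to arbitrary boolean events, because the union bounds below split off
    conditions of non-vanishing. *)
Definition rare_pred c B := forall A : {fset k},
  (#|[set f : {ffun T -> A} | B (fun t => val (f t))]| * #|` A|%fset
     <= c * #|{ffun T -> A}|)%N.

Lemma rare_pred_false c B : (forall v, B v = false) -> rare_pred c B.
Proof.
move=> B0 A; suff -> : [set f : {ffun T -> A} | B (fun t => val (f t))] = set0.
  by rewrite cards0.
by apply/setP => f; rewrite !inE B0.
Qed.

Lemma rare_pred_leq c c' B : (c <= c')%N -> rare_pred c B -> rare_pred c' B.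
Proof. by move=> cc' rB A; apply: leq_trans (rB A) _; rewrite leq_mul2r cc' orbT. Qed.

Lemma rare_predU c1 c2 B1 B2 B : (forall v, B v -> B1 v || B2 v) ->
  rare_pred c1 B1 -> rare_pred c2 B2 -> rare_pred (c1 + c2) B.
Proof.
move=> sub r1 r2 A; apply: leq_trans (_ : _ <= (#|[set f : {ffun T -> A} | B1 (fun t => val (f t))]|
  + #|[set f : {ffun T -> A} | B2 (fun t => val (f t))]|) * #|` A|%fset)%N _.
  rewrite leq_mul2r; apply/orP; right; apply: leq_trans (leq_card_setU _ _).
  by apply/subset_leq_card/subsetP => f; rewrite !inE; apply: sub.
by rewrite !mulnDl leq_add.
Qed.

(* (f, a) |-> f[t := a] is injective on B x A. *)
Lemma rare_pred_fiber B t :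
  (forall v a b, B (upd v t a) -> B (upd v t b) -> a = b) -> rare_pred 1 B.
Proof.
move=> fibB A; rewrite mul1n cardfE -cardsT -cardsX.
pose S := [set f : {ffun T -> A} | B (fun t => val (f t))].
pose g (p : {ffun T -> A} * A) : {ffun T -> A} := [ffun t' => if t' == t then p.2 else p.1 t'].
rewrite -(card_in_imset (f := g)) ?max_card // => -[f a] [f' a'].
rewrite !inE !andbT /= => Bf Bf' /ffunP e.
have ea : a = a' by have := e t; rewrite !ffunE eqxx.
have ef t' : t' != t -> f t' = f' t'.
  by move=> /negPf ne; have := e t'; rewrite !ffunE ne.
suff eft : f t = f' t.
  by congr pair => //; apply/ffunP => t'; have [->|/ef] := eqVneq t' t.
apply: val_inj; apply: (fibB (fun t => val (f t))); first by rewrite upd_id.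
suff -> : upd (fun t => val (f t)) t (val (f' t)) = (fun t => val (f' t)) by [].
apply: functional_extensionality => t'; rewrite /upd; have [->//|/ef ->//] := eqVneq t' t.
Qed.

Definition affine_in_one f := exists c b t, forall v, f v = c + b * v t.

(** With slope 0 the function is a nonzero constant; otherwise every line in the direction [t]
    contains at most one zero. *)
Lemma rare_affine_in_one f v0 : affine_in_one f -> f v0 != 0 ->
  rare_pred 1 (fun v => f v == 0).
Proof.
case=> c [b [t fE]]; have [b0|b0] := eqVneq b 0 => nz.
  apply: rare_pred_false => v; apply/negbTE; move: nz.
  by rewrite !fE b0 !mul0r.
apply: (rare_pred_fiber (t := t)) => v x y; rewrite !fE !upd_same.
by move=> /eqP e1 /eqP e2; apply/(mulfI b0)/(addrI c); rewrite e1 e2.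
Qed.

Definition poly_fun f := exists q : {mpoly k[#|T|]},
  forall v, q.@[fun i => v (enum_val i)] = f v.

Lemma poly_fun_const c : poly_fun (fun=> c).
Proof. by exists c%:MP => v; rewrite mevalC. Qed.

Lemma poly_fun_coord t : poly_fun (fun v => v t).
Proof. by exists 'X_(enum_rank t) => v; rewrite mevalXU enum_rankK. Qed.

Lemma poly_funD f g : poly_fun f -> poly_fun g -> poly_fun (fun v => f v + g v).
Proof. by move=> [p fp] [q gq]; exists (p + q) => v; rewrite mevalD fp gq. Qed.

Lemma poly_funM f g : poly_fun f -> poly_fun g -> poly_fun (fun v => f v * g v).
Proof. by move=> [p fp] [q gq]; exists (p * q) => v; rewrite mevalM fp gq. Qed.

Lemma poly_fun_sum (J : finType) (Q : pred J) (F : J -> (T -> k) -> k) :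
  (forall j, poly_fun (F j)) -> poly_fun (fun v => \sum_(j | Q j) F j v).
Proof.
move=> polF; have /fin_all_exists[q qF] := polF.
exists (\sum_(j | Q j) q j) => v; rewrite raddf_sum; apply: eq_bigr => j _.
exact: qF.
Qed.

Variable n : nat.
Local Notation R := {mpoly k[n]}.
Implicit Types F : (T -> k) -> R.

(** Polynomial dependence is required coefficientwise. Its closure properties yield the equation of
    the closed set without writing it out. *)
Definition poly_map F := forall m, poly_fun (fun v => (F v)@_m).

Lemma poly_map_const p : poly_map (fun=> p).
Proof. by move=> m; apply: poly_fun_const. Qed.

Lemma poly_mapD F G : poly_map F -> poly_map G -> poly_map (fun v => F v + G v).
Proof.
move=> pF pG m; have [q fq] := poly_funD (pF m) (pG m).
by exists q => v; rewrite mcoeffD.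
Qed.

Lemma poly_mapZ t p : poly_map (fun v => v t *: p).
Proof.
move=> m; have [q fq] := poly_funM (poly_fun_coord t) (poly_fun_const p@_m).
by exists q => v; rewrite mcoeffZ.
Qed.

Lemma poly_mapM F G : poly_map F -> poly_map G -> poly_map (fun v => F v * G v).
Proof.
move=> pF pG m.
have [q fq] := poly_fun_sum
  (fun x : 'X_{1..n < (mdeg m).+1, (mdeg m).+1} => m == (x.1 + x.2)%MM)
  (fun x => poly_funM (pF (bmnm x.1)) (pG (bmnm x.2))).
by exists q => v; rewrite fq mcoeffM.
Qed.

Lemma poly_map_sum (J : finType) (Q : pred J) (F : J -> (T -> k) -> R) :
  (forall j, poly_map (F j)) -> poly_map (fun v => \sum_(j | Q j) F j v).
Proof.
move=> pF m; have [q fq] := poly_fun_sum Q (fun j => pF j m).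
by exists q => v; rewrite fq raddf_sum.
Qed.

Lemma poly_mapN F : poly_map F -> poly_map (fun v => - F v).
Proof.
move=> pF m; have [q fq] := poly_funM (poly_fun_const (-1)) (pF m).
by exists q => v; rewrite fq mulN1r mcoeffN.
Qed.

End ParameterSpace.

Lemma not_reduced_groebner (k : fieldType) n (le : rel 'X_{1..n}) (I : {mpoly k[n]} -> Prop)
    (G : {fset {mpoly k[n]}}) f g m :
  term_order le -> f \in G -> g \in G -> f != 0 -> f != g -> m \in msupp g ->
  (lead_mon le f <= m)%MM -> ~ reduced_groebner le I G.
Proof.
move=> leT Gf Gg f0 fg mg fm [_ /(_ g Gg)[_ /(_ m mg)]]; apply.
by apply: (ideal_lead_terms_intro _ leT _ f0 fm); rewrite in_fsetD1 fg.
Qed.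

Lemma mcoeffXM (k : fieldType) n (p : {mpoly k[n]}) m m' :
  ('X_[m] * p)@_m' = if (m <= m')%MM then p@_(m' - m) else 0.
Proof.
rewrite mulrC; case: ifP => [mm'|nmm'].
  by rewrite -{1}(submK mm') addmC mcoeffMX.
apply: memN_msupp_eq0; rewrite (perm_mem (msuppMX _ _)).
by apply/negP => /mapP[m'' _ e]; rewrite e lem_addr in nmm'.
Qed.

(** * The sampled data as functions of the parameters *)

Section Generic.
Variables (k : fieldType) (n' d' D s : nat).
Local Notation n := n'.+1.
Local Notation R := {mpoly k[n]}.
Local Notation T := (param n' d' D s).
Local Notation powX i := (U_(@ord_max n') *+ i)%MM.
Implicit Types v : T -> k.

(** The polynomial in x_n of degree below D whose coefficients are the coordinates selected by
    [tau]: it serves for each g_j and for the nonleading part of h. *)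
Definition generic_low (tau : 'I_D -> T) v : R := \sum_(e < D) v (tau e) *: 'X_[powX e].

Definition generic_col v : 'cV[R]_n :=
  \col_i (if unlift ord0 i is Some j
          then head_var k j - generic_low (fun e => inl (inl (inr (j, e)))) v
          else 'X_[powX D] + generic_low (fun e => inl (inl (inl e))) v).

Definition generic_tri r (tau : above_diag r * 'X_{1..n < d'.+1} -> T) v : 'M[R]_r :=
  \matrix_(i, j) (if insub (i, j) is Some ij
                  then \sum_(m : 'X_{1..n < d'.+1}) v (tau (ij, m)) *: 'X_[bmnm m]
                  else (i == j)%:R).

Definition coord_U1 (x : above_diag s * 'X_{1..n < d'.+1}) : T := inl (inr x).
Definition coord_U2 (x : above_diag n * 'X_{1..n < d'.+1}) : T := inr x.

Lemma generic_triE r (tau : above_diag r * 'X_{1..n < d'.+1} -> T) v (U : 'M[R]_r) :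
  unitri d' U -> (forall ij m, v (tau (ij, m)) = (U (val ij).1 (val ij).2)@_(bmnm m)) ->
  generic_tri tau v = U.
Proof.
move=> triU vU; apply/matrixP => i j; rewrite mxE; have [Uji Uii Udeg] := triU i j.
case: insubP => [ij _ eij|/= nlt].
  rewrite (mpolywE Udeg); apply: eq_bigr => m _.
  by rewrite vU eij.
have [eij|ne] := eqVneq i j; first by rewrite Uii.
by rewrite Uji // ltn_neqAle leqNgt nlt andbT eq_sym.
Qed.

(** Nothing is lost in passing to coordinates: h is monic of degree D, and each g_j has degree below
    D. *)
Lemma generic_colE d smax (x : sample k n' s) : valid_sample d d' smax x ->
  D = (size (smp_h x)).-1 -> generic_col (@param_val k n' d' D s x) = shape_col (smp_h x) (smp_g x).
Proof.
move=> [[/monicP h_monic /andP[h_gt _]] g_le _ _ _] eD.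
have low (q : {poly k}) : (size q <= D)%N -> in_last n' q = \sum_(e < D) q`_e *: 'X_[powX e] :> R.
  move=> qD; rewrite in_lastE (big_ord_widen D (fun i => q`_i *: 'X_[powX i] : R) qD).
  rewrite big_mkcond; apply: eq_bigr => i _; case: ltnP => // ge.
  by rewrite (nth_default 0 ge) scale0r.
apply/matrixP => i j; rewrite !mxE; case: unlift => [l|].
  by rewrite (low (smp_g x l)) ?eD.
rewrite in_lastE -(prednK (ltnW h_gt)) -eD big_ord_recr /= addrC; congr (_ + _).
by move: h_monic; rewrite /lead_coef -eD => ->; rewrite scale1r.
Qed.

Lemma poly_map_generic_low tau : poly_map (generic_low tau).
Proof. by apply: poly_map_sum => e; apply: poly_mapZ. Qed.

Lemma poly_map_generic_col i : poly_map (fun v => generic_col v i 0).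
Proof.
move=> m; case E: (unlift ord0 i) => [j|].
  have [q fq] := poly_mapD (poly_map_const _ (head_var k j))
    (poly_mapN (poly_map_generic_low (fun e => inl (inl (inr (j, e)))))) m.
  by exists q => v; rewrite fq mxE E.
have [q fq] := poly_mapD (poly_map_const _ 'X_[powX D])
  (poly_map_generic_low (fun e => inl (inl (inl e)))) m.
by exists q => v; rewrite fq mxE E.
Qed.

Lemma poly_map_generic_tri r (tau : above_diag r * 'X_{1..n < d'.+1} -> T) i j :
  poly_map (fun v => generic_tri tau v i j).
Proof.
move=> m; case E: (insub (i, j) : option (above_diag r)) => [ij|].
  have [q fq] := poly_map_sum predT (fun m => poly_mapZ (tau (ij, m)) ('X_[bmnm m] : R)) m.
  by exists q => v; rewrite fq mxE E.
have [q fq] := poly_map_const T ((i == j)%:R : R) m.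
by exists q => v; rewrite fq mxE E.
Qed.

Lemma affine_generic_low (p : R) (e : k) tau m : T ->
  affine_in_one (fun v => (p + e *: generic_low tau v)@_m).
Proof.
move=> t0; case: (pickP (fun i : 'I_D => powX i == m)) => [i /eqP em|ne].
  exists p@_m, e, (tau i) => v; rewrite mcoeffD mcoeffZ raddf_sum /= (bigD1 i) //=.
  rewrite mcoeffZ mcoeffX em eqxx mulr1 big1 ?addr0 // => j nej.
  rewrite mcoeffZ mcoeffX -em; case: eqP => [|_]; last by rewrite mulr0.
  move=> /(congr1 (fun m : 'X_{1..n} => m ord_max)); rewrite !mulmnE mnm1E eqxx !mul1n.
  by move=> /val_inj eji; rewrite eji eqxx in nej.
(* No coordinate enters this coefficient; [t0] only fills the slot, with slope 0. *)
exists p@_m, 0, t0 => v; rewrite mcoeffD mcoeffZ raddf_sum /= big1 ?mulr0 ?mul0r //.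
by move=> i _; rewrite mcoeffZ mcoeffX ne mulr0.
Qed.

Lemma affine_generic_col i m m' : T ->
  affine_in_one (fun v => ('X_[m] * generic_col v i 0)@_m').
Proof.
move=> t0; have [|] := boolP (m <= m')%MM => mm'; last first.
  by exists 0, 0, t0 => v; rewrite mcoeffXM (negPf mm') mul0r addr0.
case E: (unlift ord0 i) => [j|].
  have [c [b [t ct]]] := affine_generic_low (head_var k j) (-1)
    (fun e => inl (inl (inr (j, e)))) (m' - m)%MM t0.
  by exists c, b, t => v; rewrite mcoeffXM mm' mxE E -ct scaleN1r.
have [c [b [t ct]]] := affine_generic_low 'X_[powX D] 1
  (fun e => inl (inl (inl e))) (m' - m)%MM t0.
by exists c, b, t => v; rewrite mcoeffXM mm' mxE E -ct scale1r.
Qed.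

Lemma generic_col_upd_U1 v x y : generic_col (upd v (coord_U1 x) y) = generic_col v.
Proof. by apply/matrixP => i j; rewrite !mxE. Qed.

Lemma generic_col_upd_U2 v x y : generic_col (upd v (coord_U2 x) y) = generic_col v.
Proof. by apply/matrixP => i j; rewrite !mxE. Qed.

Lemma generic_U2_upd v x y :
  generic_tri coord_U2 (upd v (coord_U1 x) y) = generic_tri coord_U2 v.
Proof. by apply/matrixP => i j; rewrite !mxE. Qed.

Lemma generic_tri_upd r (tau : above_diag r * 'X_{1..n < d'.+1} -> T) v ij0 m0 x y i j :
  injective tau ->
  generic_tri tau (upd v (tau (ij0, m0)) x) i j =
  generic_tri tau (upd v (tau (ij0, m0)) y) i j +
    (if (i, j) == val ij0 then (x - y) *: 'X_[bmnm m0] else 0).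
Proof.
move=> tau_inj; rewrite !mxE; case: insubP => [ij _ eij|nlt]; last first.
  have [eij|_] := eqVneq (i, j) (val ij0); last by rewrite addr0.
  by have := valP ij0; rewrite -eij (negPf nlt).
rewrite -eij; have [/val_inj ->|ne] := eqVneq (val ij) (val ij0); last first.
  rewrite addr0; apply: eq_bigr => m _; rewrite !upd_other //;
    by apply: contra ne => /eqP/tau_inj[->].
rewrite (bigD1 m0) //= [in RHS](bigD1 m0) //= !upd_same addrAC -scalerDl subrKC.
congr (_ + _); apply: eq_bigr => m ne; rewrite !upd_other //;
  by apply: contra ne => /eqP/tau_inj[->].
Qed.

Lemma generic_tri_diag r (tau : above_diag r * 'X_{1..n < d'.+1} -> T) v (i j : 'I_r) :
  (j <= i)%N -> generic_tri tau v i j = (i == j)%:R.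
Proof. by move=> ji; rewrite mxE insubF //= ltnNge ji. Qed.

(** Row [a] of U_2' G. Every row of P U_2 G is either zero or of this form, and w is one of these
    when it lies outside the zero block. *)
Definition generic_row (a : 'I_n) v : R := (generic_tri coord_U2 v *m generic_col v) a 0.

Lemma generic_rowE a v : generic_row a v = generic_col v a 0 +
  \sum_(c < n | (a < c)%N) generic_tri coord_U2 v a c * generic_col v c 0.
Proof.
rewrite /generic_row mxE (bigID (fun c : 'I_n => (a < c)%N)) addrC /=; congr (_ + _).
rewrite (bigD1 a) ?ltnn //= generic_tri_diag // eqxx mul1r big1 ?addr0 // => c.
case/andP=> ca ne; rewrite generic_tri_diag; last by rewrite leqNgt.
by rewrite eq_sym (negPf ne) mul0r.
Qed.

Lemma poly_map_generic_row a : poly_map (generic_row a).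
Proof.
move=> m; have [q fq] := poly_map_sum predT (fun c => poly_mapM
  (poly_map_generic_tri coord_U2 a c) (poly_map_generic_col c)) m.
by exists q => v; rewrite fq /generic_row mxE.
Qed.

Lemma tdeg_generic_low tau v : (tdeg (generic_low tau v) <= D)%N.
Proof.
apply: tdeg_sum => e; apply: leq_trans (_ : tdeg ('X_[powX e] : R) <= _)%N.
  by have := msizeZ_le ('X_[powX e] : R) (v (tau e)); rewrite /tdeg => le_m; rewrite -!subn1 leq_sub2r.
by rewrite /tdeg msizeX mdegMn mdeg1 mul1n; apply/ltnW/ltn_ord.
Qed.

Lemma tdeg_generic_row a v : (tdeg (generic_row a v) <= d' + D.+1)%N.
Proof.
apply: tdeg_mulmx => i j; apply: leq_add.
  rewrite mxE; case: insubP => [ij _ _|_]; last first.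
    by case: eqP => _; rewrite /tdeg ?msize0 ?msize1.
  apply: tdeg_sum => m; have := msizeZ_le ('X_[bmnm m] : R) (v (coord_U2 (ij, m))).
  by rewrite msizeX /tdeg; have := bmdeg m; move: (msize _) => b; lia.
rewrite mxE; case: unlift => [l|]; apply: leq_trans (tdegD _ _) _; rewrite geq_max.
  rewrite tdeg_head_var /= /tdeg msizeN; exact: leqW (tdeg_generic_low _ _).
rewrite (leqW (tdeg_generic_low _ _)) andbT.
by rewrite /tdeg msizeX mdegMn mdeg1 mul1n.
Qed.

(** At the origin U_2' is the identity, and the row is a variable or a power of x_n. This provides
    the nonzero value from which a maximal monomial can be chosen. *)
Lemma generic_row0 a : generic_row a (fun=> 0) != 0.
Proof.
have low0 tau : generic_low tau (fun=> 0) = 0.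
  by rewrite /generic_low big1 // => e _; rewrite scale0r.
have X_neq0 m : 'X_[m] != 0 :> R.
  by rewrite -msupp_eq0 msuppX.
rewrite generic_rowE big1 ?addr0 => [|c ac].
  by rewrite mxE; case: unlift => [j|]; rewrite low0 ?subr0 ?addr0 X_neq0.
rewrite mxE; case: insubP => [ij _ _|]; last by rewrite /= ac.
by rewrite big1 ?mul0r // => m _; rewrite scale0r.
Qed.

(** A uniform degree bound leaves finitely many monomials that occur for some parameter; [M] is the
    largest of them. *)
Lemma exists_max_monomial (le : rel 'X_{1..n}) (F : (T -> k) -> R) e v0 : term_order le ->
  (forall v, tdeg (F v) <= e)%N -> F v0 != 0 ->
  exists M v1, (F v1)@_M != 0 /\ forall v m, m \in msupp (F v) -> le m M.
Proof.
move=> leT Fe F0.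
pose r := [seq bmnm m | m <- enum {: 'X_{1..n < e.+1}} &
  excluded_middle_informative (exists v, (F v)@_(bmnm m) != 0)].
have rP m : reflect (exists v, (F v)@_m != 0) (m \in r).
  apply: (iffP mapP) => [[b]|[v nz]].
    by rewrite mem_filter => /andP[+ _] ->; case: excluded_middle_informative.
  have me : (mdeg m < e.+1)%N.
    rewrite -mcoeff_msupp in nz; have := msize_mdeg_lt nz; have := Fe v.
    by rewrite /tdeg; move: (msize _) => b; lia.
  exists (BMultinom me) => //; rewrite mem_filter mem_enum andbT /=.
  by case: excluded_middle_informative => // nex; case: nex; exists v.
have [m0 m0r] : exists m, m \in r.
  exists (mlead (F v0)); apply/rP; exists v0.
  by rewrite mleadc_eq0.
have [/rP[v1 nz] _] := foldr_term_order_max leT m0r.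
exists (foldr (fun a b => if le a b then b else a) 0%MM r), v1; split; first exact: nz.
move=> v m; rewrite mcoeff_msupp => nzv.
have mr : m \in r by apply/rP; exists v.
exact: (foldr_term_order_max leT mr).2.
Qed.

Lemma generic_row_upd (a c : 'I_n) v (ij : above_diag n) m x y : val ij = (a, c) ->
  generic_row a (upd v (coord_U2 (ij, m)) x) = generic_row a (upd v (coord_U2 (ij, m)) y)
    + (x - y) *: ('X_[bmnm m] * generic_col v c 0).
Proof.
move=> eij; have inj2 : injective coord_U2 by move=> ? ? [].
rewrite /generic_row [LHS]mxE [X in _ = X + _]mxE !generic_col_upd_U2.
rewrite (bigD1 c) //= [in RHS](bigD1 c) //= (generic_tri_upd v _ _ x y a c inj2).
rewrite eij eqxx mulrDl -scalerAl -!addrA; congr (_ + _); rewrite addrC; congr (_ + _).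
apply: eq_bigr => j ne; rewrite (generic_tri_upd v _ _ x y a j inj2).
by rewrite eij xpair_eqE (negPf ne) andbF addr0.
Qed.

Lemma generic_row_updM (a c : 'I_n) v (ij : above_diag n) m x y M : val ij = (a, c) ->
  (generic_row a (upd v (coord_U2 (ij, m)) x))@_M =
  (generic_row a (upd v (coord_U2 (ij, m)) y))@_M
    + (x - y) * ('X_[bmnm m] * generic_col v c 0)@_M.
Proof. by move=> eij; rewrite (generic_row_upd v m x y eij) mcoeffD mcoeffZ. Qed.

(* Otherwise failing unifications unfold the matrix product. *)
Local Opaque generic_row.

Lemma rare_generic_row a M v1 : T -> (generic_row a v1)@_M != 0 ->
  rare_pred 2 (fun v => (generic_row a v)@_M == 0).
Proof.
move=> t0 nz; pose b c m v := ('X_[m] * generic_col v c 0)@_M.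
(* [b c m] is the slope of the coefficient of [M] along the coordinate of U_2' for the monomial [m]
   in position (a, c). *)
case: (classic (exists (c : 'I_n) (m : 'X_{1..n < d'.+1}) v, (a < c)%N /\ b c m v != 0)).
  case=> c [m [v2 [ac b2]]].
  have [ij eij] : exists ij : above_diag n, val ij = (a, c) by exists (Sub (a, c) ac); rewrite SubK.
  pose t := coord_U2 (ij, m).
  (* The slope is affine in one coordinate of G, so it rarely vanishes. It does not change with
     U_2', so where it is nonzero each line along [t] has at most one zero. *)
  apply: (@rare_predU _ _ 1 1 (fun v => b c m v == 0)
    (fun v => (b c m v != 0) && ((generic_row a v)@_M == 0))).
  - by move=> v ->; case: eqP.
  - exact: rare_affine_in_one (affine_generic_col c m M t0) b2.
  apply: (rare_pred_fiber (t := t)) => v x y /andP[bx /eqP ex] /andP[_ /eqP ey].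
  move: bx ex ey; rewrite /b generic_col_upd_U2 => bx ex ey.
  have solve (A B C : k) : A = B + C -> A = 0 -> B = 0 -> C = 0.
    by move=> e1 e2 e3; rewrite -e2 e1 e3 add0r.
  have /eqP := solve _ _ _ (generic_row_updM v m x y M eij) ex ey.
  by rewrite mulf_eq0 (negPf bx) orbF subr_eq0 => /eqP.
(* All slopes vanish identically, so the coefficient is that of entry [a] of G alone, which is
   affine in one coordinate. *)
move=> nex; have rowE v : (generic_row a v)@_M = ('X_[0] * generic_col v a 0)@_M.
  rewrite generic_rowE mpolyX0 mul1r mcoeffD raddf_sum big1 ?addr0 // => c ac /=.
  rewrite mxE; case: insubP => [ij _ _|]; last by rewrite /= ac.
  rewrite mulr_suml raddf_sum big1 // => m _ /=; rewrite -scalerAl mcoeffZ.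
  apply/eqP; rewrite mulf_eq0; apply/orP; right; apply/negPn/negP => nzb.
  by apply: nex; exists c, m, v.
apply: (@rare_pred_leq _ _ 1) => //.
have := rare_affine_in_one (v0 := v1) (affine_generic_col a 0%MM M t0).
rewrite -rowE => /(_ nz) r1 A; apply: leq_trans (r1 A); rewrite leq_mul2r; apply/orP; right.
by apply/subset_leq_card/subsetP => f; rewrite !inE rowE.
Qed.

End Generic.

(** * Generic failure of F to be a reduced basis *)

Lemma stack_mulmxE (k : fieldType) n' s (U : 'M[{mpoly k[n'.+1]}]_n'.+1) (v : 'cV_n'.+1) (i : 'I_s) :
  (stack s U *m v) i 0 = if (i < n'.+1)%N then (U *m v) (inord i) 0 else 0.
Proof.
rewrite mxE; case: ifP => lti; last by rewrite big1 // => j _; rewrite mxE lti mul0r.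
by rewrite mxE; apply: eq_bigr => j _; rewrite mxE lti.
Qed.

(** Triangularity leaves only the diagonal in the last row, and one further entry in the row above.
    This exhibits w and w' + u w among the elements of F. *)
Lemma unitri_mulmx_last (k : fieldType) n' e s (U : 'M[{mpoly k[n'.+1]}]_s.+2) (v : 'cV_s.+2) :
  unitri e U -> let i := ord_max in let j := inord s in
  (U *m v) i 0 = v i 0 /\ (U *m v) j 0 = v j 0 + U j i * v i 0.
Proof.
move=> triU i j; have vj : j = s :> nat by rewrite inordK.
have nij : i != j by apply/eqP => /(congr1 val) /=; rewrite vj; lia.
have nji : j != i by rewrite eq_sym.
have diag l : U l l = 1 by have [_ ->] := triU l l.
have low (a b : 'I_s.+2) : (b < a)%N -> U a b = 0 by have [] := triU a b.
split; rewrite mxE.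
  rewrite (bigD1 i) //= diag mul1r big1 ?addr0 // => l ne.
  by rewrite low ?mul0r // ltn_neqAle ne -ltnS ltn_ord.
rewrite (bigD1 j) //= diag mul1r (bigD1 i) //= big1 ?addr0 // => l /andP[nlj nli].
rewrite low ?mul0r // vj; have := ltn_ord l.
have nls : (l != s :> nat) by apply: contra nlj => /eqP els; apply/eqP/val_inj; rewrite /= vj.
have nlS : (l != s.+1 :> nat) by exact: nli.
by lia.
Qed.

Lemma generic_not_reduced (k : fieldType) (n' d' D s : nat) (le : rel 'X_{1..n'.+1}) (P : 'S_s) :
  term_order le -> (0 < D)%N -> (0 < d')%N -> (n' < s)%N -> (1 < s)%N ->
  exists E : seq {mpoly k[#|param n' d' D s|]},
    [/\ proper_closed E, rare 3 E & forall d smax (x : sample k n' s) (I : {mpoly k[n'.+1]} -> Prop),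
      valid_sample d d' smax x -> D = (size (smp_h x)).-1 -> smp_P x = P ->
      reduced_groebner le I (entries (smp_U1 x *m
        (perm_mx (smp_P x) *m (stack s (smp_U2 x) *m shape_col (smp_h x) (smp_g x))))) ->
      zeros E (@param_val k n' d' D s x)].
Proof.
case: s P => [//|[//|s]] P leT D_gt0 d'_gt0 ns _.
pose i1 : 'I_s.+2 := ord_max; pose i0 : 'I_s.+2 := inord s.
have i01 : (i0 < i1)%N by rewrite inordK.
pose ij0 : above_diag s.+2 := Sub (i0, i1) i01.
(* The coordinate [t0] below is the coefficient of x_1 in u; it exists because d' > 0. *)
have mu_deg : (mdeg (U_(ord0) : 'X_{1..n'.+1}) < d'.+1)%N by rewrite mdeg1.
pose mu : 'X_{1..n'.+1 < d'.+1} := BMultinom mu_deg.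
pose t0 : param n' d' D s.+2 := coord_U1 D (ij0, mu).
pose a : 'I_n'.+1 := inord (P i1).
pose W v := stack s.+2 (generic_tri (@coord_U2 n' d' D s.+2) v) *m generic_col v
  : 'cV[{mpoly k[n'.+1]}]_s.+2.
have sample_rows d smax (x : sample k n' s.+2) : valid_sample d d' smax x ->
    D = (size (smp_h x)).-1 -> smp_P x = P ->
    let v := @param_val k n' d' D s.+2 x in
    let F := entries (smp_U1 x *m (perm_mx (smp_P x) *m
               (stack s.+2 (smp_U2 x) *m shape_col (smp_h x) (smp_g x)))) in
    W v (P i1) 0 \in F /\
    W v (P i0) 0 + generic_tri (@coord_U1 n' d' D s.+2) v i0 i1 * W v (P i1) 0 \in F.
  move=> valx eD eP v F; have [_ _ _ triU1 triU2] := valx.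
  rewrite /F -(generic_colE valx eD) -/v eP.
  have <- : generic_tri (@coord_U2 n' d' D s.+2) v = smp_U2 x by apply: generic_triE.
  have -> : generic_tri (@coord_U1 n' d' D s.+2) v = smp_U1 x by apply: generic_triE.
  have [e1 e0] := unitri_mulmx_last (perm_mx P *m W v) triU1.
  have permE i : (perm_mx P *m W v) i 0 = W v (P i) 0 by rewrite -row_permE mxE.
  rewrite !permE in e1 e0.
  by split; apply/entriesP; [exists i1 | exists i0]; rewrite ?e1 ?e0.
have lead0 : lead_cf le (0 : {mpoly k[n'.+1]}) == 0 by rewrite /lead_cf mcoeff0.
have [Pn|nP] := ltnP (P i1) n'.+1; last first.
  (* The last row falls in the zero block, so w = 0 belongs to F. Its leading coefficient is 0
     rather than 1, and the empty closed set, with equation 1 = 0, suffices. *)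
  exists [:: 1]; split.
  - by exists (fun=> 0); rewrite /zeros /= meval1 oner_eq0.
  - by apply: rare_pred_false => v; rewrite /zeros /= meval1 oner_eq0.
  move=> d smax x I valx eD eP; have [+ _] := sample_rows d smax x valx eD eP.
  rewrite /W stack_mulmxE ltnNge nP /= => F0 [_ /(_ _ F0)[lc1 _]].
  by rewrite lc1 oner_eq0 in lead0.
have Wa v : W v (P i1) 0 = generic_row a v by rewrite /W stack_mulmxE Pn.
have [M [v1 [nz1 maxM]]] := exists_max_monomial leT (@tdeg_generic_row k n' d' D s.+2 a)
  (generic_row0 k d' D s.+2 a).
pose row1 v := W v (P i0) 0 + generic_tri (@coord_U1 n' d' D s.+2) v i0 i1 * generic_row a v.
(* A single equation: [f] is nonzero exactly when both coefficients of the genericity argument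
   are. *)
pose f v := (generic_row a v)@_M * (row1 v)@_(bmnm mu + M)%MM.
have upd_row v (y : k) : generic_row a (upd v t0 y) = generic_row a v.
  by rewrite /generic_row generic_U2_upd generic_col_upd_U1.
(* Changing [t0] affects neither G nor U_2', hence neither w nor w'; it shifts [row1] by a multiple
   of x_1 w. *)
have updM v x y : (row1 (upd v t0 x))@_(bmnm mu + M) =
   (row1 (upd v t0 y))@_(bmnm mu + M) + (x - y) * (generic_row a v)@_M.
  have -> : row1 (upd v t0 x) = row1 (upd v t0 y) + (x - y) *: ('X_[bmnm mu] * generic_row a v).
    rewrite /row1 !upd_row /W !generic_U2_upd !generic_col_upd_U1 -addrA; congr (_ + _).
    have inj1 : injective (@coord_U1 n' d' D s.+2) by move=> ? ? [].
    by rewrite (generic_tri_upd v ij0 mu x y i0 i1 inj1) SubK eqxx mulrDl -scalerAl.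
  by rewrite mcoeffD mcoeffZ mcoeffXM lem_addr addmC addmK.
have polyW : poly_map (fun v => W v (P i0) 0).
  have [lt|nlt] := boolP (P i0 < n'.+1)%N => m.
    have [q fq] := @poly_map_generic_row k n' d' D s.+2 (inord (P i0)) m.
    by exists q => v; rewrite fq /W stack_mulmxE lt.
  have [q fq] := poly_map_const (param n' d' D s.+2) (0 : {mpoly k[n'.+1]}) m.
  by exists q => v; rewrite fq /W stack_mulmxE (negPf nlt).
have [q qf] : poly_fun f.
  apply: poly_funM; first exact: poly_map_generic_row.
  apply: poly_mapD polyW (poly_mapM _ _) _; first exact: poly_map_generic_tri.
  exact: poly_map_generic_row.
have upd_f v (y : k) : f (upd v t0 y) = (generic_row a v)@_M * (row1 (upd v t0 y))@_(bmnm mu + M).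
  by rewrite /f upd_row.
have solve (A B z x y : k) : A = B + (x - y) * z -> z != 0 -> z * A = 0 -> z * B = 0 -> x = y.
  move=> eA nz /eqP; rewrite mulf_eq0 (negPf nz) => /eqP A0 /eqP.
  rewrite mulf_eq0 (negPf nz) => /eqP B0; move: eA; rewrite A0 B0 add0r => /esym/eqP.
  by rewrite mulf_eq0 (negPf nz) orbF subr_eq0 => /eqP.
exists [:: q]; have zerosE v : zeros [:: q] v = (f v == 0) by rewrite /zeros /= andbT qf.
split.
(* At [v1] the first factor is nonzero. If the second vanishes there, raising [t0] by 1 gives it the
   value of the first. *)
- have [nzQ|zQ] := eqVneq (f v1) 0; last by exists v1; rewrite zerosE.
  exists (upd v1 t0 (v1 t0 + 1)); rewrite zerosE /f upd_row mulf_neq0 //.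
  have := updM v1 (v1 t0 + 1) (v1 t0); rewrite upd_id => ->.
  move/eqP: nzQ; rewrite /f mulf_eq0 (negPf nz1) /= => /eqP ->.
  by rewrite add0r addrAC subrr add0r mul1r.
(* The constant 3 is 2 for the coefficient of [M] in w, plus 1 for the other coefficient on the
   locus where the first is nonzero. *)
- apply: (@rare_predU _ _ 2 1 (fun v => (generic_row a v)@_M == 0)
    (fun v => ((generic_row a v)@_M != 0) && (f v == 0))).
  + by move=> v; rewrite -[q in q :: _]/q -/(zeros _ v) zerosE => ->; rewrite andbT orbN.
  + exact: rare_generic_row t0 nz1.
  apply: (rare_pred_fiber (t := t0)) => v x y.
  move=> /andP[nz /eqP fx] /andP[_ /eqP fy]; rewrite upd_row in nz.
  by rewrite upd_f in fx; rewrite upd_f in fy; apply: solve (updM v x y) nz fx fy.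
move=> d smax x I valx eD eP redF; rewrite zerosE; apply/negPn/negP => nzf.
have [] := sample_rows d smax x valx eD eP; set v := param_val x; rewrite Wa -/(row1 v) => F1 F2.
move: nzf; rewrite -/v mulf_eq0 negb_or => /andP[nzM nzQ].
have lead1 : lead_mon le (generic_row a v) = M.
  by apply: lead_mon_eq => //; [rewrite mcoeff_msupp | apply: maxM].
apply: (@not_reduced_groebner _ _ le I _ _ _ (bmnm mu + M)%MM leT F1 F2 _ _ _ _ redF).
- by apply/eqP => e; rewrite e mcoeff0 eqxx in nzM.
(* The two elements are distinct: x_1 M is larger than [M], so it never occurs in w. *)
- apply/eqP => e; rewrite -mcoeff_msupp -e in nzQ; have := maxM _ _ nzQ.
  have := term_order_dvd leT (lem_addl (bmnm mu) M) => le1 le2.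
  have /eqP := term_order_anti leT le1 le2.
  by rewrite -{1}[M]add0m eqm_add2r eq_sym mnm1_eq0.
- by rewrite mcoeff_msupp.
- by rewrite lead1 lem_addl.
Qed.

(** * Correctness of the output of one pass *)

Section IterationOutput.
Variables (k : fieldType) (n' c0 d d' smax s : nat) (K : costs).
Local Notation n := n'.+1.
Local Notation R := {mpoly k[n]}.
Variables (le : rel 'X_{1..n}) (fglm : {fset R} -> timed {fset R}) (x : sample k n' s).
Hypotheses (leT : term_order le) (d_gt0 : (0 < d)%N).
Hypotheses (fglmP : fglm_spec c0 le fglm) (x_valid : valid_sample d d' smax x).

Let out := (iteration K le fglm d d' x).1.
Let G0 := shape_set (smp_h x) (smp_g x).

Lemma ideal_iteration p : ideal_of out.1 p <-> ideal_of G0 p.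
Proof.
have [_ _ /andP[ns _] triU1 triU2] := x_valid.
have [B BM] := sample_matrix_left_inverse (smp_P x) ns triU1 triU2.
by rewrite /out iterationE !mulmxA -(mulmxA (smp_U1 x)); apply: ideal_entries_mulmx BM.
Qed.

Lemma sample_reduced_groebner : reduced_groebner (@lexle n) (ideal_of G0) G0.
Proof.
by have [[h_monic /andP[h_gt _]] g_le _ _ _] := x_valid; apply: shape_set_reduced_groebner.
Qed.

Lemma sample_zero_dim : zero_dim (ideal_of G0).
Proof.
by have [[_ /andP[h_gt _]] _ _ _ _] := x_valid; apply: zero_dim_shape_set.
Qed.

Lemma iteration_reduced_groebner : reduced_groebner le (ideal_of out.1) out.2.
Proof.
have eqI p : ideal_of G0 p <-> ideal_of out.1 p by split=> /ideal_iteration.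
have -> : out.2 = if excluded_middle_informative (le =2 @lexle n) then G0 else (fglm G0).1.
  by rewrite /out iterationE.
case: excluded_middle_informative => [le_lex|_] /=.
  by apply: eq_reduced_groebner sample_reduced_groebner => // m m'; rewrite le_lex.
have [red _] := fglmP sample_reduced_groebner sample_zero_dim.
exact: eq_reduced_groebner red.
Qed.

(** The output G is a Groebner basis of the ideal of F for [le], and division shows that such a
    basis generates. *)
Lemma iteration_ideals_eq p : ideal_of out.1 p <-> ideal_of out.2 p.
Proof.
have [gb _] := iteration_reduced_groebner.
by have := groebner_generates leT gb p; rewrite /ideal_of => ->.
Qed.

Lemma iteration_zero_dim : zero_dim (ideal_of out.1).
Proof.
have [B BP] := sample_zero_dim; exists B => p; have [c cP] := BP p.
by exists c; apply/ideal_iteration.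
Qed.

Lemma iteration_shape_position : shape_position (ideal_of out.1).
Proof.
exists (smp_h x), (smp_g x); apply: eq_reduced_groebner sample_reduced_groebner => // p.
by split=> /ideal_iteration.
Qed.

Lemma iteration_fglm_cost : ((fglm G0).2 <= c0 * (n * d ^ 3))%N.
Proof.
have [[_ /andP[h_gt h_le]] _ _ _ _] := x_valid.
have [_ cost] := fglmP sample_reduced_groebner sample_zero_dim.
apply: leq_trans (cost _ _ h_gt erefl) _; rewrite !leq_mul2l; apply/orP; right.
by rewrite leq_exp2r // -subn1 leq_subLR.
Qed.

End IterationOutput.

(* Assembly over the whole dataset *)
Local Close Scope ring_scope.

Theorem theorem4p8 :
  exists c : nat, forall c0 : nat, exists C : nat,
  forall (k : fieldType) (n' : nat) (le : rel 'X_{1..n'.+1}) (d d' smax : nat)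
    (K : costs) (fglm : {fset {mpoly k[n'.+1]}} -> timed {fset {mpoly k[n'.+1]}}),
  term_order le -> 0 < d -> 0 < d' -> n'.+1 <= smax ->
  admissible c0 K -> fglm_spec c0 le fglm ->
  exists Z : forall (D s : nat) (P : 'S_s), seq {mpoly k[#|param n' d' D s|]},
    (forall (D s : nat) (P : 'S_s),
       0 < D <= d -> n'.+1 <= s <= smax -> 1 < s ->
       proper_closed (Z D s P) /\ rare c (Z D s P)) /\
    forall (m : nat) (s : 'I_m -> nat) (x : forall i : 'I_m, sample k n' (s i)),
    (forall i : 'I_m, valid_sample d d' smax (x i)) ->
    let run := dataset K le fglm d d' x in
    (forall i : 'I_m,
       let F := (run.1 i).1 in
       let G := (run.1 i).2 in
       let G0 := shape_set (smp_h (x i)) (smp_g (x i)) in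
       let D := (size (smp_h (x i))).-1 in
       [/\ [/\ #|` G0| = n'.+1, le =2 @lexle n'.+1 -> G = G0 & #|` F| <= smax],
           reduced_groebner le (ideal_of F) G,
           reduced_groebner le (ideal_of F) F ->
             zeros (Z D (s i) (smp_P (x i))) (@param_val k n' d' D (s i) (x i))
         & [/\ forall p, ideal_of F p <-> ideal_of G p,
               zero_dim (ideal_of F)
             & shape_position (ideal_of F)]]) /\
    let basic :=
      \sum_(i < m) (n'.+1 * cost_sample K 1 d
                    + s i ^ 2 * cost_sample K n'.+1 d'
                    + (n'.+1 ^ 2 + s i ^ 2) * cost_mul K n'.+1 (2 * d' + d)) in
    (le =2 @lexle n'.+1 -> run.2 <= C * basic) /\
    (~ (le =2 @lexle n'.+1) -> run.2 <= C * (basic + m * n'.+1 * d ^ 3)).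
Proof.
(* In the running time, [3 * c0.+1] pays for a pass without change of ordering, and [c0] for
   FGLM. *)
exists 3 => c0; exists (3 * c0.+1 + c0).
move=> k n' le d d' smax K fglm leT d_gt0 d'_gt0 _ K_adm fglmP.
(* The closed set is chosen from D, s and P alone, before any sample is given. *)
have Z D s (P : 'S_s) : {E : seq {mpoly k[#|param n' d' D s|]} |
    (0 < D <= d -> n'.+1 <= s <= smax -> 1 < s -> proper_closed E /\ rare 3 E) /\
    forall (x : sample k n' s), valid_sample d d' smax x -> D = (size (smp_h x)).-1 ->
      smp_P x = P -> let F := (iteration K le fglm d d' x).1.1 in
      reduced_groebner le (ideal_of F) F -> zeros E (@param_val k n' d' D s x)}.
  apply: constructive_indefinite_description.
  have [/and3P[D_gt0 ns s_gt1]|nparam] := boolP [&& 0 < D, n' < s & 1 < s].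
    have [E [propE rareE redE]] := generic_not_reduced k P leT D_gt0 d'_gt0 ns s_gt1.
    exists E; split=> // x valx eD eP F; rewrite /F iterationE; exact: redE valx eD eP.
  (* Outside the range where a proper closed set is claimed, the empty list of equations serves: all
     points are zeros. This includes s = 1. *)
  exists [::]; split=> // /andP[D_gt0 _] /andP[ns _] s_gt1.
  by rewrite D_gt0 ns s_gt1 in nparam.
exists (fun D s P => sval (Z D s P)); split=> [D s P|m s x x_valid run].
  exact: (svalP (Z D s P)).1.
split=> [i F G G0 D|basic].
  split.
  - split; first by have [[_ /andP[h_gt _]] _ _ _ _] := x_valid i; apply: card_shape_set.
      rewrite /G [run.1 i]iterationE => le_lex /=.
      by case: excluded_middle_informative.
    rewrite /F [run.1 i]iterationE; apply: leq_trans (card_entries _) _.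
    by have [_ _ /andP[]] := x_valid i.
  - exact: iteration_reduced_groebner fglmP (x_valid i).
  - exact: (svalP (Z D (s i) (smp_P (x i)))).2.
  - split; [exact: iteration_ideals_eq fglmP (x_valid i)
           |exact: iteration_zero_dim (x_valid i)|exact: iteration_shape_position (x_valid i)].
have total : run.2 <= 3 * c0.+1 * basic +
    m * (if excluded_middle_informative (le =2 @lexle n'.+1) then 0 else c0 * (n'.+1 * d ^ 3)).
  rewrite -[X in X * (if _ then _ else _)](card_ord m) -sum_nat_const big_distrr -big_split.
  apply: leq_sum => i _;
  exact: (iteration_cost K_adm d_gt0 (x_valid i)
    (fun _ => iteration_fglm_cost fglmP (x_valid i))).
split=> le_lex; apply: leq_trans total _; case: excluded_middle_informative => le_lex' //=.
  by rewrite muln0 addn0 leq_mul2r leq_addr orbT.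
rewrite mulnDr leq_add ?leq_mul2r ?leq_addr ?orbT //.
by rewrite mulnCA -mulnA leq_mul2r leq_addl orbT.
Qed.
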